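(* Let $n\geq 2$, $p \in (1,n)$, $\alpha\in\mathbb{R}$, and let $\Omega \subset \mathbb{R}^n$ be a bounded domain with Lipschitz boundary such that $\Omega^{\mathrm{ext}}$ is connected. Then $$\lambda_1(\alpha, p,n,\Omega^\mathrm{ext}) < 0 \quad \Longleftrightarrow \quad \alpha < \alpha^*(p,n,\Omega^\mathrm{ext}).$$
   Context: For a bounded Lipschitz domain $\Omega\subset\mathbb{R}^n$ (not required to be connected), $\Omega^{\mathrm{ext}}:=\mathbb{R}^n\setminus\overline{\Omega}$, and $$\lambda_1(\alpha, p,n, \Omega^{\mathrm{ext}}) := \inf_{u \in W^{1,p}(\Omega^{\mathrm{ext}}),\ u\neq 0} \frac{\int_{\Omega^{\mathrm{ext}}} | \nabla u|^{p} \, \mathrm{d}x + \alpha \int_{\partial \Omega} |u|^p \, \mathrm{d}S}{\int_{\Omega^{\mathrm{ext}} } |u|^p \, \mathrm{d}x},$$ with boundary values in the sense of traces. For $p\in(1,n)$ the space $E^{1,p}(\Omega^{\mathrm{ext}})$ of finite $p$-energy functions consists of all $u$ with: (i) $u \in L^1_{\mathrm{loc}}(\Omega^\mathrm{ext})$; (ii) $|\nabla u| \in L^p(\Omega^{\mathrm{ext}})$ (weak gradient); (iii) for every $c>0$ the set $\{ x \in \Omega^{\mathrm{ext}}: | u(x) | \geq c \}$ has finite measure. Set $$\mu_1(p,n,\Omega^\mathrm{ext}) := \inf_{u \in E^{1,p}(\Omega^\mathrm{ext}),\ u|_{\partial\Omega}\neq 0} \frac{\int_{\Omega^\mathrm{ext}}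 | \nabla u |^p \, \mathrm{d}x}{\int_{\partial \Omega} | u |^p \, \mathrm{d}S},\qquad \alpha^*(p,n,\Omega^\mathrm{ext}):= -\mu_1(p,n,\Omega^\mathrm{ext}).$$ ($\mu_1$ is the first eigenvalue of the $p$-harmonic Steklov problem $\Delta_p u=0$ in $\Omega^{\mathrm{ext}}$, $-|\nabla u|^{p-2}\partial_\nu u=\mu|u|^{p-2}u$ on $\partial\Omega$, where $\nu$ is the unit normal pointing out of $\Omega$. It is known, from work of Han, that the infimum is attained.) *)

(* Defs.v *)
From HB Require Import structures.
From mathcomp Require Import all_boot all_order all_algebra.
From mathcomp Require Import all_classical all_reals all_analysis.

Set Implicit Arguments.
Unset Strict Implicit.
Unset Printing Implicit Defensive.

Import Order.TTheory GRing.Theory Num.Theory.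
Import numFieldNormedType.Exports.

Local Open Scope classical_set_scope.
Local Open Scope ring_scope.

(* The norm of the library on 'rV[R]_n is the maximum norm (same topology and
   same Lipschitz functions); lengths and diameters use the Euclidean one. *)
Section euclidean.
Context {R : realType} {n : nat}.
Implicit Types (x y : 'rV[R]_n) (A : set 'rV[R]_n).

Definition dot x y : R := \sum_(i < n) x ord0 i * y ord0 i.

Definition enorm x : R := Num.sqrt (dot x x).

Definition ediam A : \bar R :=
  ereal_sup [set (enorm (z.1 - z.2))%:E | z in A `*` A].

Definition boundary A : set 'rV[R]_n := closure A `\` A°.

Definition exterior A : set 'rV[R]_n := ~` closure A.

End euclidean.

(* Outer measure obtained by covering with arbitrary sets weighted by tau; the
   empty set always has weight 0, so that finite covers are allowed. *)
Section cover_outer.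
Local Open Scope ereal_scope.
Context {R : realType} {T : pointedType}.
Implicit Types (tau : set T -> \bar R) (A : set T).

Definition weight tau A : \bar R := if `[< A = set0 >] then 0 else tau A.

Definition cover_outer tau A : \bar R :=
  ereal_inf [set \sum_(k <oo) weight tau (F k) |
             F in [set F : (set T)^nat | A `<=` \bigcup_k F k]].

Lemma weight0 tau : weight tau set0 = 0.
Proof. by rewrite /weight asboolT. Qed.

Lemma cover_outerE tau A : cover_outer tau A =
  mu_ext (weight tau : set (g_sigma_algebraType [set: set T]) -> \bar R) A.
Proof.
rewrite /cover_outer /mu_ext; congr ereal_inf; apply/seteqP.
split=> _ [F AF <-]; exists F => //; last by case: AF.
by split=> // k; exact: sub_sigma_algebra.
Qed.

Lemma le_cover_outer tau :
  {homo cover_outer tau : A B / A `<=` B >-> A <= B}.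
Proof. by move=> A B AB; rewrite !cover_outerE; exact: le_mu_ext. Qed.

Section nonnegative_weight.
Variable tau : set T -> \bar R.
Hypothesis tau_ge0 : forall A, 0 <= weight tau A.

Lemma cover_outer0 : cover_outer tau set0 = 0.
Proof. by rewrite cover_outerE; apply: mu_ext0 => //; exact: weight0. Qed.

Lemma cover_outer_ge0 A : 0 <= cover_outer tau A.
Proof. by rewrite cover_outerE; exact: mu_ext_ge0. Qed.

Lemma cover_outer_sigma_subadditive : sigma_subadditive (cover_outer tau).
Proof.
move=> F; rewrite cover_outerE.
under eq_eseriesr do rewrite cover_outerE.
by apply: mu_ext_sigma_subadditive => //; exact: weight0.
Qed.

End nonnegative_weight.

End cover_outer.

Section lebesgue.
Local Open Scope ereal_scope.
Context {R : realType} (n : nat).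
Implicit Types (a b : 'rV[R]_n) (A : set 'rV[R]_n).

Definition box a b : set 'rV[R]_n :=
  [set x | forall i, (a ord0 i <= x ord0 i <= b ord0 i)%R].

(* Infimum of the volumes of the boxes containing A, +oo if A is unbounded. *)
Definition box_volume A : \bar R :=
  ereal_inf [set (\prod_(i < n) (ab.2 ord0 i - ab.1 ord0 i))%:E |
    ab in [set ab : 'rV[R]_n * 'rV[R]_n |
      (forall i, (ab.1 ord0 i <= ab.2 ord0 i)%R) /\ A `<=` box ab.1 ab.2]].

Definition lebesgue_cover : set 'rV[R]_n -> \bar R := cover_outer box_volume.

Lemma weight_box_volume_ge0 A : 0 <= weight box_volume A.
Proof.
rewrite /weight; case: ifPn => // _.
apply: le_ereal_inf_tmp => _ [[a b] [/= ab _] <-].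
by rewrite lee_fin; apply: prodr_ge0 => i _; rewrite subr_ge0.
Qed.

HB.instance Definition _ := isOuterMeasure.Build R _ lebesgue_cover
  (cover_outer0 weight_box_volume_ge0) (cover_outer_ge0 weight_box_volume_ge0)
  (@le_cover_outer _ _ _) (cover_outer_sigma_subadditive weight_box_volume_ge0).

Definition lebesgue_outer : {outer_measure set 'rV[R]_n -> \bar R} :=
  lebesgue_cover.

(* Lebesgue measure, on the sigma-algebra of Lebesgue measurable sets. *)
Definition leb : {measure set (caratheodory_type lebesgue_outer) -> \bar R} :=
  lebesgue_outer.

End lebesgue.

Section hausdorff.
Local Open Scope ereal_scope.
Context {R : realType} (n m : nat).
Implicit Types (A : set 'rV[R]_n) (d : R).

Definition ball_volume : \bar R :=
  lebesgue_outer m [set x : 'rV[R]_m | (enorm x <= 1)%R].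

Definition hausdorff_weight d A : \bar R :=
  if ediam A <= d%:E then ball_volume * (ediam A * 2^-1%:E) ^+ m else +oo.

(* m-dimensional Hausdorff outer measure, normalised so that it agrees with
   the m-dimensional area of Lipschitz graphs. *)
Definition hausdorff_sup A : \bar R :=
  ereal_sup [set cover_outer (hausdorff_weight d) A | d in [set d | (0 < d)%R]].

Lemma weight_hausdorff_weight_ge0 d A : 0 <= weight (hausdorff_weight d) A.
Proof.
rewrite /weight; case: asboolP => // /eqP/set0P[x Ax].
rewrite /hausdorff_weight; case: ifPn => // _.
apply: mule_ge0; first exact: outer_measure_ge0.
apply: expe_ge0; apply: mule_ge0; last by rewrite lee_fin invr_ge0.
apply: (@le_trans _ _ (enorm (x - x))%:E); first by rewrite lee_fin sqrtr_ge0.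
by apply: ereal_sup_ubound; exists (x, x).
Qed.


Lemma hausdorff_sup0 : hausdorff_sup set0 = 0.
Proof.
apply/eqP; rewrite eq_le; apply/andP; split.
  apply: ge_ereal_sup => _ [d _ <-].
  by rewrite cover_outer0 => // A; exact: weight_hausdorff_weight_ge0.
apply: (@le_trans _ _ (cover_outer (hausdorff_weight 1) set0)).
  by apply: cover_outer_ge0 => A; exact: weight_hausdorff_weight_ge0.
by apply: ereal_sup_ubound; exists 1%R => //=; exact: ltr01.
Qed.

Lemma hausdorff_sup_ge0 A : 0 <= hausdorff_sup A.
Proof.
apply: (@le_trans _ _ (cover_outer (hausdorff_weight 1) A)).
  by apply: cover_outer_ge0 => B; exact: weight_hausdorff_weight_ge0.
by apply: ereal_sup_ubound; exists 1%R => //=; exact: ltr01.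
Qed.

Lemma le_hausdorff_sup :
  {homo hausdorff_sup : A B / A `<=` B >-> A <= B}.
Proof.
move=> A B AB; apply: ge_ereal_sup => _ [d d0 <-].
apply: (le_trans (le_cover_outer _ AB)).
by apply: ereal_sup_ubound; exists d.
Qed.

Lemma hausdorff_sup_sigma_subadditive : sigma_subadditive hausdorff_sup.
Proof.
move=> F; apply: ge_ereal_sup => _ [d d0 <-].
have w0 := weight_hausdorff_weight_ge0 d.
apply: (le_trans (cover_outer_sigma_subadditive w0 F)).
apply: lee_nneseries => [k _ _|k _]; first exact: cover_outer_ge0.
by apply: ereal_sup_ubound; exists d.
Qed.

HB.instance Definition _ := isOuterMeasure.Build R _ hausdorff_sup
  hausdorff_sup0 hausdorff_sup_ge0 le_hausdorff_sup
  hausdorff_sup_sigma_subadditive.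

Definition hausdorff_outer : {outer_measure set 'rV[R]_n -> \bar R} :=
  hausdorff_sup.

Definition hausdorff :
    {measure set (caratheodory_type hausdorff_outer) -> \bar R} :=
  hausdorff_outer.

End hausdorff.

Section sobolev.
Context {R : realType} {n : nat}.
Implicit Types (U K : set 'rV[R]_n) (u f phi g : 'rV[R]_n -> R)
  (G : 'rV[R]_n -> 'rV[R]_n) (p alpha : R).

Definition partial (i : 'I_n) f : 'rV[R]_n -> R := 'D_(delta_mx ord0 i) f.

Definition grad f : 'rV[R]_n -> 'rV[R]_n := fun x => \row_i partial i f x.

Definition C1 f : Prop := forall i : 'I_n,
  (forall x, derivable f x (delta_mx ord0 i)) /\ continuous (partial i f).

Definition smooth f : Prop := forall s : seq 'I_n, C1 (foldr partial f s).

Definition test_function U phi : Prop :=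
  smooth phi /\
  exists K, [/\ compact K, K `<=` U & forall x, ~ K x -> phi x = 0].

Definition loc_integrable U f : Prop := forall K, compact K -> K `<=` U ->
  (leb n).-integrable K (EFin \o f).

Definition weak_gradient U u G : Prop :=
  [/\ loc_integrable U u,
      forall i, loc_integrable U (fun x => G x ord0 i) &
      forall phi, test_function U phi -> forall i,
        \int[leb n]_(x in U) (u x * partial i phi x) =
        - \int[leb n]_(x in U) (G x ord0 i * phi x)].

Definition in_Lp d (T : measurableType d) (mu : {measure set T -> \bar R})
    (D : set T) p (f : T -> R) : Prop :=
  measurable_fun D f /\ (\int[mu]_(x in D) (`|f x| `^ p)%:E < +oo)%E.

Definition sobolev p U u G : Prop :=
  [/\ weak_gradient U u G, in_Lp (leb n) U p u &
      in_Lp (leb n) U p (enorm \o G)].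

Definition finite_energy p U u G : Prop :=
  [/\ weak_gradient U u G, in_Lp (leb n) U p (enorm \o G) &
      forall c : R, 0 < c -> (leb n (U `&` [set x | (c <= `|u x|)%R]) < +oo)%E].

Definition surface := @hausdorff R n n.-1.

(* g is the boundary trace of u on the boundary of Omega, u being defined on
   the exterior of Omega: the trace operator is the extension by continuity
   of the restriction map of functions that are C^1 up to the boundary.  As
   the boundary is compact, convergence near it (on bounded parts of the
   exterior domain) is what matters; it is also all that is available for
   functions of finite energy, which need not belong to L^p. *)
Definition trace p (Omega : set 'rV[R]_n) u G g : Prop :=
  in_Lp surface (boundary Omega) p g /\
  exists v : nat -> 'rV[R]_n -> R,
  [/\ forall k, C1 (v k),
      forall r : R,
        (\int[leb n]_(x in exterior Omega `&` [set x | (enorm x < r)%R])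
           (`|v k x - u x| `^ p)%:E)%E @[k --> \oo] --> 0%E,
      forall r : R,
        (\int[leb n]_(x in exterior Omega `&` [set x | (enorm x < r)%R])
           (enorm (grad (v k) x - G x) `^ p)%:E)%E @[k --> \oo] --> 0%E &
      (\int[surface]_(x in boundary Omega)
         (`|v k x - g x| `^ p)%:E)%E @[k --> \oo] --> 0%E].

(* e is the direction of the last axis of a rotated coordinate system and
   y - dot y e *: e is the horizontal part of y, so that only the values of
   gamma on the hyperplane orthogonal to e matter. *)
Definition lipschitz_boundary (Omega : set 'rV[R]_n) : Prop :=
  forall x, boundary Omega x ->
  exists (e : 'rV[R]_n) (gamma : 'rV[R]_n -> R),
  [/\ enorm e = 1, lipschitz gamma &
      \forall y \near x,
        Omega y <-> gamma (y - dot y e *: e) < dot y e].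

(* In both infima G and g are determined almost everywhere by u, as its weak
   gradient and its trace; the integrals in the quotients are finite and the
   denominators positive, so that real division is meaningful. *)
Definition lambda1 (alpha p : R) (Omega : set 'rV[R]_n) : \bar R :=
  ereal_inf [set q : \bar R | exists u G g,
    [/\ sobolev p (exterior Omega) u G,
        trace p Omega u G g,
        ~ {ae leb n, forall x, exterior Omega x -> u x = 0} &
        q = ((\int[leb n]_(x in exterior Omega) (enorm (G x) `^ p) +
              alpha * \int[surface]_(x in boundary Omega) (`|g x| `^ p)) /
             \int[leb n]_(x in exterior Omega) (`|u x| `^ p))%:E]].

Definition mu1 p (Omega : set 'rV[R]_n) : \bar R :=
  ereal_inf [set q : \bar R | exists u G g,
    [/\ finite_energy p (exterior Omega) u G,
        trace p Omega u G g,
        ~ {ae surface, forall x, boundary Omega x -> g x = 0} &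
        q = (\int[leb n]_(x in exterior Omega) (enorm (G x) `^ p) /
             \int[surface]_(x in boundary Omega) (`|g x| `^ p))%:E]].

Definition alpha_star p (Omega : set 'rV[R]_n) : \bar R := (- mu1 p Omega)%E.

End sobolev.

(* Main.v *)
(**
If lambda1 < 0, a test function u of the Rayleigh quotient with negative
numerator has finite energy, by Chebyshev's inequality, and a trace that does
not vanish almost everywhere; its Steklov quotient is then smaller than
- alpha.

Conversely let u have finite energy, gradient G, trace g and Steklov quotient
smaller than - alpha; in particular alpha < 0.  Compose u with an even bounded
C^1 function T with Lipschitz derivative, |T'| <= 1, and T = 0 on [-d, d].
Since {|u| >= d} has finite measure, T(u) is in L^p; its gradient T'(u) G is
not larger than G, its trace is T(g), and the integral of |T(g)|^p tends to
that of |g|^p when d tends to 0 and T(s) tends to |s|.  So the numerator of the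
Rayleigh quotient of T(u) is negative for small d.  If T(u) = 0 almost
everywhere, the multiples s T(g) are traces of the zero function, hence also
of any C^1 function phi compactly supported in the exterior domain, and the
numerator of the triple (phi, grad phi, s T(g)) is negative for large s.  The
trace theorem and the Sobolev inequality are thus avoided.

Integration by parts for C^1 functions follows from the translation invariance
of Lebesgue measure.  Open sets are measurable for both outer measures: boxes
are cut by half-spaces for Lebesgue measure, and Hausdorff measure is a metric
outer measure.
*)
Require Import Defs.
From mathcomp Require Import all_boot all_order all_algebra.
From mathcomp Require Import all_classical all_reals all_analysis.
From mathcomp Require Import measurable_realfun measurable_fun_approximation.
From mathcomp Require Import ring lra.

Set Implicit Arguments.
Unset Strict Implicit.
Unset Printing Implicit Defensive.

Import Order.TTheory GRing.Theory Num.Theory.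
Import numFieldNormedType.Exports.

Local Open Scope classical_set_scope.
Local Open Scope ring_scope.

(** * Lebesgue measurability of boxes and open sets *)

(** The C^1 functions v_k supplied by [trace] are the only link between u, its gradient G and its
    trace g, so every property of T(u) is derived from T(v_k). The delicate limit is that of T'(v_k)
    grad v_k: it contains (T'(v_k) - T'(u)) G, where G is merely in L^p and v_k tends to u merely in
    L^p on bounded parts. The Lipschitz bound on T' controls the first factor by |v_k - u| where |G|
    is below a large level, and |T'| <= 1 controls the part of |G| above it. This is why T is C^1
    with Lipschitz derivative instead of a piecewise linear cut-off; it also keeps T(v_k) of class
    C^1, as [trace] demands.

    The case T(u) = 0 almost everywhere cannot be dismissed, because no uniqueness of traces is
    established: T(g) might a priori be nonzero all the same. T' vanishes wherever T does, so the
    gradient of T(u) is then null as well, and the pair can be added to any admissible triple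
    without changing function or gradient.

    Crude constants such as 2^p are harmless where they only multiply quantities that tend to 0. *)

Section cover_outer_split.
Local Open Scope ereal_scope.
Context {R : realType} {T : pointedType}.
Implicit Types (tau : set T -> \bar R) (A B F X : set T).

(** Intersecting a cover of X with A and with B gives covers of the two pieces, so superadditivity
    of the weight on single sets passes to the infimum over covers. It serves half-spaces for
    Lebesgue measure and distant sets for Hausdorff measure. *)
Lemma cover_outer_split tau A B X :
  (forall F, 0 <= weight tau F) ->
  (forall F, weight tau (F `&` A) + weight tau (F `&` B) <= weight tau F) ->
  cover_outer tau (X `&` A) + cover_outer tau (X `&` B) <= cover_outer tau X.
Proof.
move=> tau0 tauAB; apply: le_ereal_inf_tmp => _ [F XF <-].
apply: (@le_trans _ _ (\sum_(k <oo) (weight tau (F k `&` A)) +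
                       \sum_(k <oo) (weight tau (F k `&` B)))).
  apply: leeD; apply: ereal_inf_lbound.
    by exists (fun k => F k `&` A) => //; rewrite /= -setI_bigcupl; exact: setSI.
  by exists (fun k => F k `&` B) => //; rewrite /= -setI_bigcupl; exact: setSI.
rewrite -nneseriesD//; apply: lee_nneseries => k _ //.
by rewrite adde_ge0.
Qed.

End cover_outer_split.

Section lebesgue_cover.
Local Open Scope ereal_scope.
Context {R : realType} (n : nat).
Implicit Types (a b : 'rV[R]_n) (A F : set 'rV[R]_n).

Lemma weight_box_volume_le a b F : (forall i, (a ord0 i <= b ord0 i)%R) ->
  F `<=` box a b ->
  weight (@box_volume R n) F <= (\prod_(i < n) (b ord0 i - a ord0 i))%:E.
Proof.
move=> ab Fab; rewrite /weight; case: ifPn => _.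
  by rewrite lee_fin; apply: prodr_ge0 => i _; rewrite subr_ge0.
by apply: ereal_inf_lbound; exists (a, b).
Qed.

Let upd a (i : 'I_n) (c : R) : 'rV[R]_n :=
  \row_j (if j == i then c else a ord0 j).

(** The hyperplane cuts an enclosing box into two boxes whose volumes add up to that of the box. *)
Lemma halfspace_measurable (i : 'I_n) (c : R) :
  measurable ([set x | (x ord0 i <= c)%R] :
    set (caratheodory_type (@lebesgue_outer R n))).
Proof.
set H := (X in measurable X).
apply: le_caratheodory_measurable => X.
apply: cover_outer_split; first exact: weight_box_volume_ge0.
move=> F; rewrite {3}/weight; case: asboolP => [->|F0].
  by rewrite !set0I !weight0 adde0.
apply: le_ereal_inf_tmp => _ [[a b] [/= ab Fab] <-].
(* If F lies on one side, c may fall outside the i-th edge and a cut box would have a negative side;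
   the empty piece then has weight 0. Otherwise points on both sides force c into the edge. *)
have [FH0|/set0P[x [Fx Hx]]] := eqVneq (F `&` H) set0.
  by rewrite FH0 weight0 add0e; apply: weight_box_volume_le => // x [/Fab].
have [FH0|/set0P[y [Fy Hy]]] := eqVneq (F `&` ~` H) set0.
  by rewrite FH0 weight0 adde0; apply: weight_box_volume_le => // z [/Fab].
have ac : (a ord0 i <= c)%R.
  by have /andP[ax _] := Fab _ Fx i; exact: le_trans Hx.
have cb : (c <= b ord0 i)%R.
  have /andP[_ yb] := Fab _ Fy i; apply: le_trans yb.
  by apply: ltW; rewrite ltNge; exact/negP.
apply: (@le_trans _ _ ((\prod_(j < n) ((upd b i c) ord0 j - a ord0 j))%:E +
                       (\prod_(j < n) (b ord0 j - (upd a i c) ord0 j))%:E)).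
  apply: leeD; apply: weight_box_volume_le.
  - by move=> j; rewrite mxE; case: eqP => [->|].
  - move=> z [Fz Hz] j; have /andP[az zb] := Fab _ Fz j.
    by rewrite mxE az /=; case: eqP => [->|].
  - by move=> j; rewrite mxE; case: eqP => [->|].
  - move=> z [Fz Hz] j; have /andP[az zb] := Fab _ Fz j.
    rewrite mxE zb andbT; case: eqP => [->|//].
    by apply: ltW; rewrite ltNge; exact/negP.
have -> : (\prod_(j < n) ((upd b i c) ord0 j - a ord0 j) =
    (c - a ord0 i) * \prod_(j < n | j != i) (b ord0 j - a ord0 j))%R.
  rewrite (bigD1 i)//= mxE eqxx; congr (_ * _)%R.
  by apply: eq_bigr => j /negbTE ji; rewrite mxE ji.
have -> : (\prod_(j < n) (b ord0 j - (upd a i c) ord0 j) =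
    (b ord0 i - c) * \prod_(j < n | j != i) (b ord0 j - a ord0 j))%R.
  rewrite (bigD1 i)//= mxE eqxx; congr (_ * _)%R.
  by apply: eq_bigr => j /negbTE ji; rewrite mxE ji.
rewrite -EFinD lee_fin [leRHS](bigD1 i)//= -mulrDl.
by rewrite addrC addrA subrK.
Qed.

Lemma box_measurable a b :
  measurable (box a b : set (caratheodory_type (@lebesgue_outer R n))).
Proof.
(* Only half-spaces of the form x_i <= c are at hand, so a_i <= x_i is expressed as avoiding all
   those with c = a_i - 1/(k+1). *)
rewrite [X in measurable X](_ : _ = \bigcap_(i in [set: 'I_n])
    ([set x : 'rV[R]_n | (x ord0 i <= b ord0 i)%R] `&`
     ~` (\bigcup_k [set x : 'rV[R]_n | (x ord0 i <= a ord0 i - k.+1%:R^-1)%R]))).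
  apply: fin_bigcap_measurable => // i _; apply: measurableI.
    exact: halfspace_measurable.
  by apply: measurableC; apply: bigcupT_measurable => k;
    exact: halfspace_measurable.
apply/seteqP; split => [x xab i _|x xab i].
  have /andP[ax xb] := xab i; split => //= -[k _ /=].
  by apply/negP; rewrite -ltNge; apply: lt_le_trans ax; rewrite gtrBl invr_gt0.
have [/= -> xa] := xab i I; rewrite andbT leNgt; apply/negP => xai.
have : (0 < a ord0 i - x ord0 i)%R by rewrite subr_gt0.
move=> /ltr_add_invr[k]; rewrite add0r => /ltW kx; apply: xa; exists k => //=.
by rewrite lerBrDl -lerBrDr.
Qed.

Lemma leb_box_le a b : (forall i, (a ord0 i <= b ord0 i)%R) ->
  leb n (box a b) <= (\prod_(i < n) (b ord0 i - a ord0 i))%:E.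
Proof.
move=> ab; apply: (@le_trans _ _ (\sum_(k <oo) weight (@box_volume R n)
    (if k == 0%N then box a b else set0))).
  by apply: ereal_inf_lbound; exists (fun k => if k == 0%N then box a b else set0)
    => // x xab; exists 0%N.
rewrite (nneseries_split 0 1)//; last by move=> k _; exact: weight_box_volume_ge0.
rewrite add0n big_nat1/= eseries0 ?adde0; last first.
  by move=> k; case: k => // k _ _; rewrite weight0.
exact: weight_box_volume_le.
Qed.

End lebesgue_cover.

Section open_boxes.
Context {R : realType} (n : nat).
Implicit Types (a b : 'rV[R]_n) (U : set 'rV[R]_n).

Lemma box_compact a b : compact (box a b).
Proof.
rewrite [X in compact X](_ : _ = [set v : 'rV[R]_n | forall i,
    (`[a ord0 i, b ord0 i]%classic : set R) (v ord0 i)]); last first.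
  by apply/seteqP; split => x xab i; have := xab i; rewrite /= in_itv.
apply: (@rV_compact R n (fun i => `[a ord0 i, b ord0 i]%classic)) => i.
exact: segment_compact.
Qed.

(* The cubes come from the grids of mesh 1/(m+1). *)
Lemma open_bigcup_box U : open U -> exists2 K : nat -> set 'rV[R]_n,
  forall k, K k = set0 \/ exists a b, K k = box a b & U = \bigcup_k K k.
Proof.
move=> oU.
pose J := ('rV[int]_n * nat)%type.
pose lo (j : J) : 'rV[R]_n := \row_i ((j.1 ord0 i)%:~R / j.2.+1%:R).
pose hi (j : J) : 'rV[R]_n := \row_i (((j.1 ord0 i)%:~R + 1) / j.2.+1%:R).
pose K k := if unpickle k is Some j then
  if `[< box (lo j) (hi j) `<=` U >] then box (lo j) (hi j) else set0 else set0.
exists K.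
  move=> k; rewrite /K; case: unpickle => [j|]; last by left.
  by case: ifP => _; [right; exists (lo j), (hi j)|left].
apply/seteqP; split => [x Ux|x [k _]]; last first.
  by rewrite /K; case: unpickle => // j; case: asboolP => // + xj; exact.
have /nbhs_ballP[e e0 eU] : nbhs x U by exact: open_nbhs_nbhs.
have [m] := ltr_add_invr e0; rewrite add0r => me.
pose j : J := (\row_i Num.floor (x ord0 i * m.+1%:R), m).
have m0 : 0 < m.+1%:R :> R by [].
have xj : box (lo j) (hi j) x.
  move=> i; rewrite !mxE ler_pdivrMr// ler_pdivlMr// floor_le_tmp.
  by rewrite ltW// (_ : _ + 1 = (Num.floor (x ord0 i * m.+1%:R) + 1)%:~R)
    ?floorD1_gt// intrD.
exists (pickle j) => //; rewrite /K pickleK asboolT// => y yj.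
apply: eU; rewrite mx_norm_ball /ball_ /= [ltLHS]/Num.norm /= mx_normrE; apply/bigmax_ltP.
split => //= -[i0 i] _ /=; rewrite (ord1 i0) !mxE.
apply: le_lt_trans me.
have /andP[] := xj i; have /andP[] := yj i; rewrite !mxE /=.
rewrite mulrDl mul1r; set f := _ / _; set d := m.+1%:R^-1.
move: f d (x ord0 i) (y ord0 i) => f d s t fs sf ft tf.
by rewrite ler_norml; apply/andP; split; lra.
Qed.

Lemma open_measurable_leb U : open U ->
  measurable (U : set (caratheodory_type (@lebesgue_outer R n))).
Proof.
move=> /open_bigcup_box[K Kbox ->]; apply: bigcupT_measurable => k.
case: (Kbox k) => [->|[a [b ->]]]; [exact: measurable0|exact: box_measurable].
Qed.

Lemma bounded_set_box (A : set 'rV[R]_n) : bounded_set A ->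
  exists2 r : R, 0 < r & A `<=` box (const_mx (- r)) (const_mx r).
Proof.
move=> [M [_ MA]]; exists (`|M| + 1) => [|x Ax i]; first by rewrite ltr_wpDl.
rewrite !mxE -ler_norml; apply: (@le_trans _ _ `|x|).
  rewrite [leRHS]/Num.norm /= mx_normrE.
  exact: (le_bigmax _ (fun i : 'I_1 * 'I_n => `|x i.1 i.2|) (ord0, i)).
by apply: MA => //; rewrite (le_lt_trans (ler_norm _))// ltrDl.
Qed.

Lemma leb_bounded (A : set 'rV[R]_n) : bounded_set A -> (leb n A < +oo)%E.
Proof.
move=> /bounded_set_box[r r0 Ar].
apply: (@le_lt_trans _ _ (leb n (box (const_mx (- r)) (const_mx r)))).
  exact: (le_outer_measure (lebesgue_outer n)).
apply: (le_lt_trans (leb_box_le _)); last exact: ltry.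
by move=> i; rewrite !mxE; lra.
Qed.

End open_boxes.

Lemma ge0_integral_preserving d (T : measurableType d) (R : realType)
    (mu : {measure set T -> \bar R}) (phi : T -> T) (mphi : measurable_fun setT phi)
    (f : T -> \bar R) :
  (forall A, measurable A -> mu (phi @^-1` A) = mu A) ->
  measurable_fun setT f -> (forall x, (0 <= f x)%E) ->
  (\int[mu]_x f (phi x) = \int[mu]_x f x)%E.
Proof.
move=> muphi mf f0.
rewrite -(@ge0_integral_pushforward _ _ _ _ _ _ mphi mu setT f measurableT mf)//.
by apply: eq_measure_integral => A mA _; exact: muphi.
Qed.

(** * Translation invariance of Lebesgue measure *)

Section translation.
Local Open Scope ereal_scope.
Context {R : realType} (n : nat).
Implicit Types (h : 'rV[R]_n) (A : set 'rV[R]_n).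

(** Translating a cover translates the enclosing boxes without changing their volumes; the reverse
    inequality will be this one for [- h]. *)
Let shift_preimage_le h A :
  lebesgue_outer n ((fun x => x + h)%R @^-1` A) <= lebesgue_outer n A.
Proof.
apply: le_ereal_inf_tmp => _ [F AF <-].
apply: (@le_trans _ _ (\sum_(k <oo) weight (@box_volume R n)
    ((fun x => x + h)%R @^-1` F k))).
  apply: ereal_inf_lbound; exists (fun k => (fun x => x + h)%R @^-1` F k) => //.
  by move=> x /AF[k _ Fk]; exists k.
apply: lee_nneseries => [k _ _|k _]; first exact: weight_box_volume_ge0.
rewrite {2}/weight; case: asboolP => [->|_]; first by rewrite preimage_set0 weight0.
apply: le_ereal_inf_tmp => _ [[a b] [/= ab Fab] <-].
rewrite (_ : \prod_(i < n) _ = \prod_(i < n) ((b - h) ord0 i - (a - h) ord0 i))%R.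
  apply: weight_box_volume_le => [i|x /Fab xab i]; rewrite !mxE ?lerD2r//.
  by have := xab i; rewrite !mxE lerBlDr lerBrDr.
by apply: eq_bigr => i _; rewrite !mxE; ring.
Qed.

Lemma leb_shift h A : lebesgue_outer n ((fun x => x + h)%R @^-1` A) =
  lebesgue_outer n A.
Proof.
apply/eqP; rewrite eq_le shift_preimage_le /=.
rewrite [in leLHS](_ : A = (fun x => x + (- h))%R @^-1` ((fun x => x + h)%R @^-1` A)).
  exact: shift_preimage_le.
by rewrite -comp_preimage (_ : _ \o _ = id)//; apply/funext => x /=; rewrite subrK.
Qed.

(** Every test set of the Carathéodory condition is the preimage of its own translate, so the
    condition for the preimage of Y reduces, by invariance, to the one for Y. *)
Lemma measurable_shift h (D : set (caratheodory_type (@lebesgue_outer R n))) :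
  measurable_fun D ((fun x => x + h)%R :
   caratheodory_type (@lebesgue_outer R n) -> caratheodory_type (@lebesgue_outer R n)).
Proof.
move=> mD Y mY; apply: (@measurableI _ (caratheodory_type (@lebesgue_outer R n))) => //.
set s := (fun x => _ + _)%R; move=> X.
have sK (Z : set 'rV[R]_n) : Z = s @^-1` ((fun x => x - h)%R @^-1` Z).
  by rewrite -comp_preimage (_ : _ \o _ = id)//; apply/funext => x /=; rewrite addrK.
rewrite (sK X) preimage_setC -!preimage_setI.
by rewrite (leb_shift h) (leb_shift h (_ `&` Y)) (leb_shift h (_ `&` ~` Y)) -mY.
Qed.

End translation.

(** * Metric outer measures *)

Section metric_outer_measure.
Local Open Scope ereal_scope.
Context {R : realType} {n : nat} (mu : {outer_measure set 'rV[R]_n -> \bar R}).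
Implicit Types (A B C : set 'rV[R]_n).

(** Only the nontrivial half of additivity on sets at positive distance; the other half is
    subadditivity. *)
Definition metric_outer := forall A B (e : R), (0 < e)%R ->
  (forall x y, A x -> B y -> (e <= `|x - y|)%R) -> mu A + mu B <= mu (A `|` B).

Let far C A k : set 'rV[R]_n :=
  A `&` [set x | forall y, C y -> (k.+1%:R^-1 <= `|x - y|)%R].

Let far_sub C A j k : (j <= k)%N -> far C A j `<=` far C A k.
Proof.
move=> jk x [Ax Cx]; split => // y /Cx; apply: le_trans.
by rewrite lef_pV2 ?posrE// ler_nat.
Qed.

Let ring C A k := far C A k.+2 `\` far C A k.+1.

(** A point of [ring C A k] is closer than 1/(k+2) to some point of C, from which [far C A k] keeps
    distance 1/(k+1); the two sets are thus separated by the difference. Skipping one index in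
    [ring] creates this gap. *)
Let far_ring C A k : metric_outer ->
  mu (far C A k) + mu (ring C A k) <= mu (far C A k.+2).
Proof.
move=> mum; apply: (@le_trans _ _ (mu (far C A k `|` ring C A k))).
  apply: (mum _ _ (k.+1%:R^-1 - k.+2%:R^-1)%R).
    by rewrite subr_gt0 ltf_pV2 ?posrE// ltr_nat.
  move=> x z [_ Cx] [[Az Cz]] /not_andP[//|/existsNP[y /not_implyP[Cy /negP]]].
  rewrite -ltNge => zy; have xy := Cx _ Cy.
  rewrite lerBlDr; apply: (le_trans xy); apply: (le_trans (ler_distD z x y)).
  by rewrite lerD2l ltW.
apply: le_outer_measure => x [/far_sub|[]//]; apply.
by rewrite -addn2 leq_addr.
Qed.

(** Carathéodory's criterion. The part of A outside C is exhausted by the sets [far C A k], which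
    are separated from C; what they miss is covered by rings around C, and the tail of the ring
    series tends to 0. *)
Lemma metric_closed_measurable C : metric_outer -> closed C ->
  mu.-caratheodory C.
Proof.
move=> mum cC; apply: le_caratheodory_measurable => A.
have [->|muA] := eqVneq (mu A) +oo; first exact: leey.
have muAoo : mu A < +oo by rewrite ltey.
have far_le k : mu (far C A k) <= mu A.
  by apply: le_outer_measure => x [].
(* Consecutive rings may touch, but rings with indices of the same parity are separated, so their
   measures add up inside A. The two parities together bound the whole series by twice mu A. *)
have parity b N : \sum_(0 <= j < N) mu (ring C A (j.*2 + b)) <= mu (far C A (N.*2 + b)).
  elim: N => [|N IH]; first by rewrite big_geq.
  rewrite big_nat_recr//= doubleS !addSn; apply: le_trans (far_ring _ _ _ mum).
  exact: leeD.
have ring_sum N : \sum_(0 <= j < N) mu (ring C A j) <= mu A + mu A.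
  apply: (@le_trans _ _ (\sum_(0 <= j < N.*2) mu (ring C A j))).
    by apply: lee_sum_nneg_natr => //; rewrite -addnn leq_addr.
  apply: (@le_trans _ _ (\sum_(0 <= j < N) mu (ring C A (j.*2 + 0)) +
                         \sum_(0 <= j < N) mu (ring C A (j.*2 + 1)))).
    elim: N => [|N IH]; first by rewrite !big_geq// adde0.
    rewrite doubleS !big_nat_recr//= addn0 addn1.
    by rewrite addeACA addeA leeD// leeD.
  by apply: leeD; exact: le_trans (far_le _).
have ring_fin : \sum_(j <oo) mu (ring C A j) < +oo.
  apply: (@le_lt_trans _ _ (mu A + mu A)); last by rewrite lte_add_pinfty.
  by apply: lime_le; [exact: is_cvg_nneseries|exact: nearW].
have tail k : mu (A `&` C) + mu (A `&` ~` C) <=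
    mu A + \sum_(k <= j <oo) mu (ring C A j).
  apply: (@le_trans _ _ (mu (A `&` C) + (mu (far C A k.+1) +
      \sum_(k <= j <oo) mu (ring C A j)))).
    rewrite leeD2l//.
    have -> : \sum_(k <= j <oo) mu (ring C A j) =
        \sum_(j <oo) mu (ring C A (k + j)%N).
      by rewrite -(nneseries_addn k)//; apply: eq_eseriesr => // i _; rewrite addnC.
    apply: (@le_trans _ _ (mu (far C A k.+1 `|` \bigcup_j ring C A (k + j)%N))).
      apply: le_outer_measure => x [Ax Cx].
      (* This is where closedness of C enters: a point off C has a positive distance to it. *)
      have [N /= xN] : exists N, far C A N x.
        have /nbhs_ballP[e e0 eC] : nbhs x (~` C).
          by apply: open_nbhs_nbhs; split => //; exact: closed_openC.
        have [N] := ltr_add_invr e0; rewrite add0r => Ne.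
        exists N; split => // y Cy; rewrite leNgt; apply/negP => xy.
        apply: (eC y) => //; rewrite mx_norm_ball /ball_ /=.
        exact: lt_trans Ne.
      have [Nk|kN] := leqP N k.+1; first by left; apply: far_sub xN.
      elim: N kN xN => // N IH; rewrite ltnS leq_eqVlt => /predU1P[<- xN|kN xN].
        have [xk|xk] := pselect (far C A k.+1 x); first by left.
        by right; exists 0%N => //; rewrite addn0.
      have [/IH|xk] := pselect (far C A N x); first exact.
      (* Here x lies in [far C A N.+1] but not in [far C A N], that is, in the ring of index N -
         1. *)
      right; exists (N - k.+1)%N => //.
      have e : (k + (N - k.+1)).+1 = N by rewrite -addSn subnKC// ltnW.
      by rewrite /ring e.
    apply: le_trans (outer_measureU2 _ _ _) _; rewrite leeD2l//.
    exact: outer_measure_sigma_subadditive.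
  rewrite addeA leeD2r//.
  apply: (@le_trans _ _ (mu ((A `&` C) `|` far C A k.+1))).
    apply: (mum _ _ k.+2%:R^-1%R) => // x y [_ Cx] [_ /(_ _ Cx)].
    by rewrite distrC.
  by apply: le_outer_measure => x [[]|[]].
have cvg0 := nneseries_tail_cvg ring_fin (fun k _ => outer_measure_ge0 mu _).
rewrite -[leRHS]adde0.
apply: (cvge_ge (f := fun k => mu A + \sum_(k <= j <oo) mu (ring C A j))
  (F := \oo)); first exact: nearW.
by apply: cvgeD => //; [exact: fin_num_adde_defl|exact: cvg_cst].
Qed.

End metric_outer_measure.

Section hausdorff_metric.
Local Open Scope ereal_scope.
Context {R : realType} (n m : nat).
Implicit Types (A B F : set 'rV[R]_n).

Lemma norm_le_enorm k (x : 'rV[R]_k) : (`|x| <= enorm x)%R.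
Proof.
rewrite [leLHS]/Num.norm /= mx_normrE; apply/bigmax_leP; split.
  exact: sqrtr_ge0.
move=> [i0 i] _ /=; rewrite (ord1 i0) -sqrtr_sqr ler_wsqrtr// /dot (bigD1 i)//= -expr2.
by rewrite lerDl; apply: sumr_ge0 => j _; rewrite -expr2 sqr_ge0.
Qed.

Let ediam_ge0 F : F !=set0 -> 0 <= ediam F.
Proof.
move=> [x Fx]; apply: (@le_trans _ _ (enorm (x - x))%:E).
  by rewrite lee_fin sqrtr_ge0.
by apply: ereal_sup_ubound; exists (x, x).
Qed.

Let le_ediam A B : A `<=` B -> ediam A <= ediam B.
Proof.
move=> AB; apply: ge_ereal_sup => _ [[x y] [/= Ax Ay] <-].
by apply: ereal_sup_ubound; exists (x, y) => //; split; exact: AB.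
Qed.

Let le_expe (x y : \bar R) k : 0 <= x -> x <= y -> x ^+ k <= y ^+ k.
Proof.
move=> x0 xy; elim: k => // k IH; rewrite !expeS.
by apply: lee_pmul => //; exact: expe_ge0.
Qed.

Let weight_mono (d : R) A B : A `<=` B ->
  weight (@hausdorff_weight R n m d) A <= weight (@hausdorff_weight R n m d) B.
Proof.
move=> AB; have [->|/set0P A0] := eqVneq A set0.
  by rewrite weight0; exact: weight_hausdorff_weight_ge0.
have B0 : B !=set0 by case: A0 => x /AB; exists x.
rewrite /weight !asboolF; [|by apply/eqP/set0P..].
rewrite /hausdorff_weight; case: (leP (ediam B)) => [Bd|_]; last exact: leey.
have AdB := le_ediam AB.
rewrite (le_trans AdB)//; apply: lee_wpmul2l.
  exact: (outer_measure_ge0 (lebesgue_outer m)).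
apply: le_expe; first by apply: mule_ge0; [exact: ediam_ge0|rewrite lee_fin].
by rewrite lee_wpmul2r// lee_fin.
Qed.

Let cover_outer_anti (d1 d2 : R) A : (d1 <= d2)%R ->
  cover_outer (@hausdorff_weight R n m d2) A <=
  cover_outer (@hausdorff_weight R n m d1) A.
Proof.
move=> d12; apply: le_ereal_inf_tmp => _ [F AF <-].
apply: (@le_trans _ _ (\sum_(k <oo) weight (@hausdorff_weight R n m d2) (F k))).
  by apply: ereal_inf_lbound; exists F.
apply: lee_nneseries => [k _ _|k _]; first exact: weight_hausdorff_weight_ge0.
rewrite /weight; case: asboolP => // _; rewrite /hausdorff_weight.
by case: (leP (ediam (F k)) d1%:E) => [/le_trans-> //|_]; exact: leey.
Qed.

(** At a scale d <= e/2 a set meeting both A and B has diameter at least e > d, hence infinite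
    weight; every other set contributes to only one of the two covers. *)
Lemma hausdorff_metric_outer : metric_outer (@hausdorff_outer R n m).
Proof.
move=> A B e e0 ABe.
have sep (d1 d2 : R) : (0 < d1)%R -> (0 < d2)%R ->
    cover_outer (@hausdorff_weight R n m d1) A +
    cover_outer (@hausdorff_weight R n m d2) B <= hausdorff_sup m (A `|` B).
  move=> d10 d20; pose d := Num.min (Num.min d1 d2) (e / 2)%R.
  have d0 : (0 < d)%R by rewrite !lt_min d10 d20 divr_gt0.
  apply: (@le_trans _ _ (cover_outer (@hausdorff_weight R n m d) (A `|` B))); last first.
    by apply: ereal_sup_ubound; exists d.
  apply: (@le_trans _ _ (cover_outer (@hausdorff_weight R n m d) A +
                         cover_outer (@hausdorff_weight R n m d) B)).
    by apply: leeD; apply: cover_outer_anti; rewrite !ge_min lexx ?orbT.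
  have {1}-> : A = (A `|` B) `&` A by rewrite setUK.
  have {2}-> : B = (A `|` B) `&` B by rewrite setIC setKU.
  apply: cover_outer_split => [F|F]; first exact: weight_hausdorff_weight_ge0.
  have [->|/set0P[x [Fx Ax]]] := eqVneq (F `&` A) set0.
    by rewrite weight0 add0e; exact: weight_mono.
  have [->|/set0P[y [Fy By]]] := eqVneq (F `&` B) set0.
    by rewrite weight0 adde0; exact: weight_mono.
  rewrite {3}/weight asboolF; last by move=> F0; rewrite F0 in Fx.
  rewrite /hausdorff_weight ifF ?leey//; apply/negbTE; rewrite -ltNge.
  apply: (@lt_le_trans _ _ (enorm (x - y))%:E); last first.
    by apply: ereal_sup_ubound; exists (x, y).
  rewrite lte_fin; apply: lt_le_trans (norm_le_enorm _).
  apply: lt_le_trans (ABe _ _ Ax By).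
  by rewrite !gt_min; apply/orP; right; rewrite ltr_pdivrMr// ltr_pMr// ltr1n.
have [->|Hoo] := eqVneq (hausdorff_outer n m (A `|` B)) +oo; first exact: leey.
have Hfin : hausdorff_outer n m (A `|` B) \is a fin_num.
  by rewrite ge0_fin_numE ?ltey// outer_measure_ge0.
have fin F (d : R) : F `<=` A `|` B -> (0 < d)%R ->
    cover_outer (@hausdorff_weight R n m d) F \is a fin_num.
  move=> FAB d0; rewrite ge0_fin_numE; last first.
    by apply: cover_outer_ge0 => ?; exact: weight_hausdorff_weight_ge0.
  apply: (@le_lt_trans _ _ (hausdorff_outer n m (A `|` B))); last by rewrite ltey.
  apply: le_trans (le_outer_measure (hausdorff_outer n m) _ _ FAB).
  by apply: ereal_sup_ubound; exists d.
have HB : hausdorff_outer n m B \is a fin_num.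
  rewrite ge0_fin_numE ?outer_measure_ge0//.
  apply: (@le_lt_trans _ _ (hausdorff_outer n m (A `|` B))); last by rewrite ltey.
  by apply: le_outer_measure; exact: subsetUr.
(* The suprema over the two scales are taken one at a time; each time the other term must be finite
   to be moved across the inequality. *)
rewrite -leeBrDr//; apply: ge_ereal_sup => _ [d1 d10 <-].
rewrite leeBrDr// -leeBrDl; last by apply: fin => //; exact: subsetUl.
apply: ge_ereal_sup => _ [d2 d20 <-].
rewrite leeBrDl; last by apply: fin => //; exact: subsetUl.
exact: sep.
Qed.

Lemma closed_measurable_hausdorff A : closed A ->
  measurable (A : set (caratheodory_type (@hausdorff_outer R n m))).
Proof.
by move=> cA; apply: metric_closed_measurable => //; exact: hausdorff_metric_outer.
Qed.

Lemma open_measurable_hausdorff A : open A ->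
  measurable (A : set (caratheodory_type (@hausdorff_outer R n m))).
Proof.
move=> oA; rewrite -[A]setCK; apply: measurableC.
by apply: closed_measurable_hausdorff; exact: open_closedC.
Qed.

End hausdorff_metric.

(** * The measure of a box *)

Section lebesgue_box_volume.
Local Open Scope ereal_scope.
Context {R : realType}.

Let in01 (a b t : R) : R := \1_(`[a, b]%classic : set R) t.

(* Integrating the hypothesis over one coordinate at a time turns the pointwise
   covering of a box into the inequality between volumes. *)
Lemma le_box_cover n (a b : nat -> R) (l h : nat -> nat -> R) (c : nat -> R) (v : R) :
  (0 <= v)%R -> (forall i, (a i <= b i)%R) -> (forall k, (0 <= c k)%R) ->
  (forall k i, (l k i <= h k i)%R) ->
  (forall x : nat -> R, (forall i, (a i <= x i <= b i)%R) ->
    v%:E <= \sum_(k <oo) (c k * \prod_(i < n) in01 (l k i) (h k i) (x i))%:E) ->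
  (v * \prod_(i < n) (b i - a i))%:E <=
    \sum_(k <oo) (c k * \prod_(i < n) (h k i - l k i))%:E.
Proof.
elim: n c v => [|n IH] c v v0 ab c0 lh cover.
  have := cover a _; rewrite !big_ord0 mulr1.
  under eq_eseriesr do rewrite big_ord0.
  by under [X in _ -> _ <= X]eq_eseriesr do rewrite big_ord0; apply => i; rewrite lexx ab.
rewrite big_ord_recr/= [X in (_ * X)%R]mulrC mulrA.
under eq_eseriesr do rewrite big_ord_recr/= [X in (_ * X)%R]mulrC mulrA.
(* The edges of coordinate n have been absorbed into [v] and [c], which is why the statement carries
   these factors. The cover required by the induction hypothesis comes from integrating the given
   one over that coordinate. *)
apply: IH => // [|k|x xab].
- by rewrite mulr_ge0// subr_ge0.
- by rewrite mulr_ge0// subr_ge0.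
pose D : set R := `[a n, b n]%classic.
have mD : measurable D := measurable_itv _.
pose f k (t : R) := (c k * (\prod_(i < n) in01 (l k i) (h k i) (x i)) *
  in01 (l k n) (h k n) t)%R.
have ck0 k : (0 <= c k * \prod_(i < n) in01 (l k i) (h k i) (x i))%R.
  by rewrite mulr_ge0// prodr_ge0.
have mf k : measurable_fun D (EFin \o f k).
  apply/measurable_EFinP; apply: measurable_funM => //.
  by apply: measurable_indic; exact: measurable_itv.
have f0 k t : D t -> 0 <= (f k t)%:E by move=> _; rewrite lee_fin mulr_ge0.
apply: (@le_trans _ _ (\int[lebesgue_measure]_(t in D) (v%:E))).
  rewrite integral_cst; last exact: measurable_itv.
  have := lebesgue_measure_itv `[a n, b n]; rewrite -/D /= lte_fin => ->.
  case: ltP => [_|ba]; first by rewrite -EFinB -EFinM.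
  by rewrite mule0 lee_fin mulr_ge0_le0// subr_le0.
apply: (@le_trans _ _ (\int[lebesgue_measure]_(t in D) \sum_(k <oo) (f k t)%:E)).
  apply: ge0_le_integral => //.
  - by apply: ge0_emeasurable_sum => [k t Dt _|k _]; [exact: f0|exact: mf].
  move=> t; rewrite /D /= in_itv /= => Dt.
  pose y i := if i == n then t else x i.
  have := cover y _; set s1 := \sum_(k <oo) _; set s2 := \sum_(k <oo) _.
  have -> : s1 = s2.
    apply: eq_eseriesr => k _; rewrite big_ord_recr/= /f mulrA /y eqxx.
    congr (_ * _ * _)%:E; apply: eq_bigr => i _.
    by rewrite (ltn_eqF (ltn_ord i)).
  by apply => i; rewrite /y; case: eqP => // ->.
rewrite integral_nneseries//.
apply: lee_nneseries => [k _ _|k _]; first by apply: integral_ge0 => t; exact: f0.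
rewrite /f; under eq_integral do rewrite EFinM.
rewrite ge0_integralZl//; last 2 first.
- by move=> t _; rewrite lee_fin.
- by rewrite lee_fin.
rewrite integral_indic//.
rewrite [leRHS](_ : _ = (c k * \prod_(i < n) in01 (l k i) (h k i) (x i))%:E *
    (h k n - l k n)%:E); last by rewrite -EFinM mulrAC.
apply: lee_wpmul2l; first by rewrite lee_fin.
apply: (@le_trans _ _ (lebesgue_measure (`[l k n, h k n]%classic : set R))).
  by apply: le_measure; rewrite ?inE; [apply: measurableI; exact: measurable_itv|
    exact: measurable_itv|exact: subIsetl].
have := lebesgue_measure_itv `[l k n, h k n]; rewrite /= lte_fin => ->.
by case: ifPn => // _; rewrite lee_fin subr_ge0.
by apply/measurable_EFinP/measurable_indic; exact: measurable_itv.
Qed.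

(** Compactness is not invoked: a countable cover by boxes bounds the indicator of the box from
    above by a sum of indicators, which [le_box_cover] integrates. It is needed to see that a bump
    does not vanish almost everywhere. *)
Lemma leb_box_ge n (a b : 'rV[R]_n) : (forall i, a ord0 i <= b ord0 i)%R ->
  (\prod_(i < n) (b ord0 i - a ord0 i))%:E <= leb n (box a b).
Proof.
move=> ab; apply: le_ereal_inf_tmp => _ [F abF <-].
have w0 := @weight_box_volume_ge0 R n.
have [->|] := eqVneq (\sum_(k <oo) weight (@box_volume R n) (F k)) +oo; first exact: leey.
rewrite -ltey => sumoo.
have wfin k : weight (@box_volume R n) (F k) \is a fin_num.
  rewrite ge0_fin_numE//; apply: le_lt_trans sumoo.
  rewrite (nneseries_split 0 k.+1)// add0n big_nat_recr//=.
  rewrite -[leLHS]adde0; apply: leeD; last exact: nneseries_ge0.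
  by rewrite -[leLHS]add0e leeD// sume_ge0.
apply/lee_addgt0Pr => e e0.
(* Each member of the cover is enlarged to a box at the cost e / 2^(k+1). The coefficient is 0 for
   an empty member, whose weight is 0, and 1 otherwise. *)
have boxes k : exists clh : R * ('rV[R]_n * 'rV[R]_n),
    [/\ (0 <= clh.1)%R, (forall i, clh.2.1 ord0 i <= clh.2.2 ord0 i)%R,
      forall x, F k x -> clh.1 = 1%R /\ box clh.2.1 clh.2.2 x &
      (clh.1 * \prod_(i < n) (clh.2.2 ord0 i - clh.2.1 ord0 i))%:E <=
        weight (@box_volume R n) (F k) + (e / (2 ^ k.+1)%:R)%:E].
  have e2 : (0 < e / (2 ^ k.+1)%:R)%R by rewrite divr_gt0// ltr0n expn_gt0.
  have [Fk0|/set0P Fk0] := eqVneq (F k) set0.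
    exists (0%R, (0%R, 0%R)); split => //=; first by rewrite Fk0.
    by rewrite mul0r Fk0 weight0 add0e lee_fin ltW.
  have := wfin k; rewrite /weight asboolF; last by apply/eqP/set0P.
  move=> /lb_ereal_inf_adherent => /(_ _ e2)[_ [[l h] [/= lh Fkb] <-]] vol.
  exists (1%R, (l, h)); split => //=; last by rewrite mul1r ltW.
  by move=> x /Fkb.
pose g k := projT1 (cid (boxes k)).
have gP k := projT2 (cid (boxes k)).
have {}abF : forall x : nat -> R, (forall i : 'I_n, a ord0 i <= x i <= b ord0 i)%R ->
    1%:E <= \sum_(k <oo) ((g k).1 * \prod_(i < n)
      in01 ((g k).2.1 ord0 i) ((g k).2.2 ord0 i) (x i))%:E.
  move=> x xab; pose y : 'rV[R]_n := \row_i x i.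
  have [k _ Fky] : (\bigcup_k F k) y by apply: abF => i; rewrite mxE.
  have [c0 _ /(_ _ Fky)[c1 yb] _] := gP k.
  rewrite (nneseries_split 0 k.+1)/=; last first.
    move=> j _; rewrite lee_fin mulr_ge0//; last by rewrite prodr_ge0.
    by have [] := gP j.
  rewrite add0n big_nat_recr//= -[leLHS]adde0; apply: leeD; last first.
    apply: nneseries_ge0 => j _ _; rewrite lee_fin mulr_ge0//; last by rewrite prodr_ge0.
    by have [] := gP j.
  rewrite -[leLHS]add0e; apply: leeD.
    apply: sume_ge0 => j _; rewrite lee_fin mulr_ge0//; last by rewrite prodr_ge0.
    by have [] := gP j.
  rewrite lee_fin c1 mul1r big1//= => i _.
  rewrite /in01 indicE mem_set//= in_itv /=.
  by have := yb i; rewrite mxE.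
(* [le_box_cover] works with sequences, so that its induction does not change the type of points;
   vectors are extended by 0. *)
pose ext (v : 'rV[R]_n) i := if insub i is Some j then v ord0 j else 0%R.
have extE v (i : 'I_n) : ext v i = v ord0 i by rewrite /ext valK.
have ext_le (u v : 'rV[R]_n) i : (forall j, u ord0 j <= v ord0 j)%R -> (ext u i <= ext v i)%R.
  by move=> uv; rewrite /ext; case: insub.
have := @le_box_cover n (ext a) (ext b) (fun k => ext (g k).2.1)
  (fun k => ext (g k).2.2) (fun k => (g k).1) 1 ler01.
rewrite mul1r; under eq_bigr do rewrite !extE.
move=> /(_ _ _ _ _)/le_trans; apply => [i|k|k i|x xab|].
- exact: ext_le.
- by have [] := gP k.
- by apply: ext_le; have [] := gP k.
- apply: (@le_trans _ _ _ _ _ (abF x _)); first by move=> i; rewrite -!extE.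
  apply: lee_nneseries => [k _ _|k _].
    by rewrite lee_fin mulr_ge0 ?prodr_ge0//; have [] := gP k.
  by rewrite lee_fin; under eq_bigr do rewrite -!extE.
apply: (@le_trans _ _ (\sum_(k <oo) (weight (@box_volume R n) (F k) +
    (e / (2 ^ k.+1)%:R)%:E))); last by apply: epsilon_trick => //; exact: ltW.
apply: lee_nneseries => [k _ _|k _].
  rewrite lee_fin mulr_ge0 ?prodr_ge0//; first by have [] := gP k.
  by move=> i _; rewrite subr_ge0; apply: ext_le; have [] := gP k.
under eq_bigr do rewrite !extE.
by have [] := gP k.
Qed.

End lebesgue_box_volume.

(** * Functions of class C^1 *)

Section directional.
Context {R : realType} {V : normedModType R}.
Implicit Types (f : V -> R) (x v : V).

(** Both difference quotients are the same function of h. One-variable theorems, such as the mean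
    value theorem and the chain rule, thereby apply to directional derivatives without any
    differential of f. *)
Lemma is_derive_line f x v (t d : R) :
  is_derive (x + t *: v) v f d <-> is_derive t 1 (fun h : R => f (x + h *: v)) d.
Proof.
have E : (fun h : R => h^-1 *: ((f \o shift (x + t *: v)) (h *: v) - f (x + t *: v))) =
  (fun h : R => h^-1 *: (((fun h : R => f (x + h *: v)) \o shift t) (h *: 1) - f (x + t *: v))).
  apply/funext => h /=; congr (_ *: (f _ - _)).
  by rewrite scaler1 scalerDl addrCA.
split=> [[fx fd]|[fx fd]]; split.
- by move: fx; rewrite /derivable E.
- by move: fd; rewrite /derive E.
- by move: fx; rewrite /derivable -E.
- by move: fd; rewrite /derive -E.
Qed.

Lemma is_derive_mvt f x v (h : R) : (forall t : R, derivable f (x + t *: v) v) ->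
  exists2 t : R, `|t| <= `|h| & f (x + h *: v) - f x = h * 'D_v f (x + t *: v).
Proof.
move=> df; pose g (t : R) := f (x + t *: v).
have dg (t : R) : is_derive t 1 g ('D_v f (x + t *: v)).
  by apply/is_derive_line/derivableP.
have cg (a b : R) : {within `[a, b], continuous g}.
  by apply: derivable_within_continuous => t _; have [] := dg t.
have g0 : g 0 = f x by rewrite /g scale0r addr0.
have [h0|h0] := leP 0 h.
  have [t] := MVT_segment h0 (fun t _ => dg t) (cg _ _).
  rewrite in_itv/= subr0 g0 => /andP[t0 th] E; exists t; first by rewrite !ger0_norm.
  by rewrite mulrC.
have [t] := MVT_segment (ltW h0) (fun t _ => dg t) (cg _ _).
rewrite in_itv/= sub0r g0 => /andP[th t0] E; exists t.
  by rewrite !ler0_norm ?lerN2// ltW.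
by rewrite mulrC -[LHS]opprB E mulrN opprK.
Qed.

Lemma is_derive_comp (T : R -> R) (dT : R) f x v d :
  is_derive x v f d -> is_derive (f x) 1 T dT ->
  is_derive x v (T \o f) (dT * d).
Proof.
move=> fx Tx; have xE : x = x + 0 *: v by rewrite scale0r addr0.
rewrite xE; apply/is_derive_line.
have gx : is_derive (0 : R) 1 (fun h : R => f (x + h *: v)) d.
  by apply/is_derive_line; rewrite -xE.
have Tx' : is_derive ((fun h : R => f (x + h *: v)) 0) 1 T dT by rewrite -xE.
exact: (is_derive1_comp Tx' gx).
Qed.

End directional.

Section C1_functions.
Context {R : realType} {n : nat}.
Implicit Types (f g : 'rV[R]_n -> R) (x y : 'rV[R]_n) (i : 'I_n).

Lemma C1_is_derive f i x : C1 f -> is_derive x (delta_mx ord0 i) f (partial i f x).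
Proof. by move=> /(_ i)[/(_ x) fx _]; exact: derivableP. Qed.

Lemma C1P f (df : 'I_n -> 'rV[R]_n -> R) :
  (forall i x, is_derive x (delta_mx ord0 i) f (df i x)) ->
  (forall i, continuous (df i)) ->
  C1 f /\ (forall i, partial i f = df i).
Proof.
move=> fdf cdf; have E i : partial i f = df i.
  by apply/funext => x; rewrite /partial; apply: derive_val.
by split => // i; split => [x|]; [have [] := fdf i x|rewrite E].
Qed.

Lemma coord_le_norm x i : `|x ord0 i| <= `|x|.
Proof.
rewrite [leRHS]/Num.norm /= mx_normrE.
exact: (le_bigmax _ (fun i : 'I_1 * 'I_n => `|x i.1 i.2|) (ord0, i)).
Qed.

Let path x y (k : nat) : 'rV[R]_n := \row_j (if (j < k)%N then y ord0 j else x ord0 j).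

(** Walk from x to y changing one coordinate at a time and apply the mean value theorem to each of
    the n steps. In the maximum norm no point of the path is farther from x than y is, so the bound
    on the partial derivatives stays available. *)
Lemma C1_lipschitz_near f x (r M : R) :
  C1 f -> (forall i z, `|x - z| < r -> `|partial i f z| <= M) ->
  forall y, `|x - y| < r -> `|f y - f x| <= M * `|x - y| *+ n.
Proof.
move=> Cf fM y xy.
have pathS (k : 'I_n) : path x y k.+1 = path x y k +
    (y ord0 k - x ord0 k) *: delta_mx ord0 k.
  apply/rowP => j; rewrite !mxE eqxx/= ltnS leq_eqVlt.
  have [->|jk] := eqVneq j k; first by rewrite eqxx ltnn mulr1 addrC subrK.
  by rewrite (negbTE (_ : (j : nat) != k))// mulr0 addr0.
have -> : f y - f x = \sum_(k < n) (f (path x y k.+1) - f (path x y k)).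
  rewrite -(big_mkord xpredT (fun k => f (path x y k.+1) - f (path x y k))).
  rewrite telescope_sumr//; congr (f _ - f _); apply/rowP => j; rewrite mxE//.
  by rewrite ltn_ord.
apply: (le_trans (ler_norm_sum _ _ _)).
rewrite (_ : _ *+ n = \sum_(k < n) M * `|x - y|); last by rewrite sumr_const card_ord.
apply: ler_sum => k _.
rewrite pathS; have [|t th ->] := @is_derive_mvt _ _ f (path x y k)
  (delta_mx ord0 k) (y ord0 k - x ord0 k).
  by move=> t; have [] := Cf k.
rewrite normrM mulrC; apply: ler_pM => //; last first.
  by have := coord_le_norm (x - y) k; rewrite !mxE distrC.
apply: fM; apply: le_lt_trans xy.
rewrite [leLHS]/Num.norm /= mx_normrE; apply/bigmax_leP; split => //.
move=> [i0 j] _ /=; rewrite (ord1 i0) !mxE eqxx/=.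
have := coord_le_norm (x - y) j; rewrite !mxE.
have [->|jk] := eqVneq j k.
  rewrite ltnn mulr1 => xyk.
  by rewrite opprD addrA subrr add0r normrN (le_trans th)// distrC.
by rewrite mulr0 addr0; case: ifP => // _ _; rewrite subrr normr0.
Qed.

(** [C1] speaks of partial derivatives only; their continuity makes them bounded near x, and this
    local bound gives continuity of f. *)
Lemma C1_continuous f : C1 f -> continuous f.
Proof.
move=> Cf; suff fx (x : 'rV[R]_n) : f y @[y --> x] --> f x by move=> x; exact: fx.
have near_le i : \forall z \near x,
    `|partial i f z| <= \sum_(j < n) `|partial j f x| + 1.
  have [_ cf] := Cf i.
  have /cvgr_dist_lt /(_ _ ltr01) := cf x; apply: filterS => z fz.
  rewrite (bigD1 i)//=; have : 0 <= \sum_(j < n | j != i) `|partial j f x|.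
    by apply: sumr_ge0.
  have := ler_distD (partial i f x) (partial i f z) 0; rewrite !subr0 distrC.
  lra.
have /nbhs_ballP[r /= r0 rM] : \forall z \near x, forall i,
    `|partial i f z| <= \sum_(j < n) `|partial j f x| + 1.
  exact: (@filter_forall _ _ (fun i z => `|partial i f z| <= _) (nbhs x) _ near_le).
set M := _ + 1 in rM; have M0 : 0 < M.
  by rewrite ltr_wpDl// sumr_ge0.
rewrite (@cvgrPdist_lt _ _ _ (nbhs x) (nbhs_filter x)) => e e0; apply/nbhs_ballP.
(* [n.+1] instead of [n] keeps the denominator positive in dimension 0. *)
pose d := Num.min r (e / (M * n.+1%:R)).
have Mn : 0 < M * n.+1%:R by rewrite mulr_gt0.
exists d; first by rewrite /= lt_min r0 divr_gt0.
rewrite mx_norm_ball => y; rewrite /ball_ /= lt_min => /andP[xyr xye].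
rewrite distrC; apply: (@le_lt_trans _ _ (M * `|x - y| *+ n)).
  apply: (@C1_lipschitz_near _ _ r) => // i z xz; apply: rM.
  by rewrite mx_norm_ball.
rewrite -mulr_natr -mulrA [X in _ * X]mulrC mulrA.
move: xye; rewrite ltr_pdivlMr// mulrC; apply: le_lt_trans.
by rewrite ler_wpM2r// ler_wpM2l ?ler_nat// ltW.
Qed.

Lemma C1_comp f (T T' : R -> R) : C1 f ->
  (forall s : R, is_derive s 1 T (T' s)) -> continuous T' ->
  C1 (T \o f) /\ (forall i, partial i (T \o f) = fun x => T' (f x) * partial i f x).
Proof.
move=> Cf dT cT'; apply: C1P => [i x|i x].
  by apply: is_derive_comp => //; exact: C1_is_derive.
have cTf : continuous (T' \o f).
  by move=> y; apply: continuous_comp; [exact: C1_continuous|exact: cT'].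
have [_ cf] := Cf i.
exact: (continuousM (cTf x) (cf x)).
Qed.

Lemma C1D f g : C1 f -> C1 g ->
  C1 (f \+ g) /\ (forall i, partial i (f \+ g) = partial i f \+ partial i g).
Proof.
move=> Cf Cg; apply: C1P => [i x|i x].
  by apply: is_deriveD; exact: C1_is_derive.
by have [_ cf] := Cf i; have [_ cg] := Cg i; exact: (continuousD (cf x) (cg x)).
Qed.

Lemma C1Z (k : R) f : C1 f ->
  C1 (k \*o f) /\ (forall i, partial i (k \*o f) = k \*o partial i f).
Proof.
move=> Cf; apply: C1P => [i x|i x].
  by apply: (@is_deriveZ _ _ _ f); exact: C1_is_derive.
have [_ cf] := Cf i.
exact: (continuousM (@cst_continuous _ _ k x) (cf x)).
Qed.

Lemma C1M f g : C1 f -> C1 g ->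
  C1 (f \* g) /\
  (forall i, partial i (f \* g) = (f \* partial i g) \+ (g \* partial i f)).
Proof.
move=> Cf Cg; apply: C1P => [i x|i x].
  have fi := @C1_is_derive f i x Cf; have gi := @C1_is_derive g i x Cg.
  exact: (is_deriveM fi gi).
have [_ cf] := Cf i; have [_ cg] := Cg i.
have cf0 : continuous f := C1_continuous Cf.
have cg0 : continuous g := C1_continuous Cg.
have cfg : {for x, continuous (f \* partial i g)}.
  exact: (continuousM (cf0 x) (cg x)).
have cgf : {for x, continuous (g \* partial i f)}.
  exact: (continuousM (cg0 x) (cf x)).
exact: (continuousD cfg cgf).
Qed.

Lemma partial_eq0 f i (K : set 'rV[R]_n) : closed K -> (forall x, ~ K x -> f x = 0) ->
  forall x, ~ K x -> partial i f x = 0.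
Proof.
move=> cK f0 x Kx; rewrite /partial.
have nK : \forall y \near x, ~ K y.
  by apply: open_nbhs_nbhs; split => //; exact: closed_openC.
have -> : 'D_(delta_mx ord0 i) f x = 'D_(delta_mx ord0 i) (cst 0 : _ -> R) x.
  by apply: near_eq_derive; apply: filterS nK => y /f0.
exact: derive_cst.
Qed.

End C1_functions.

(** * Truncations *)

Section positive_part_derivative.
Context {R : realType}.
Implicit Types (F : R -> R) (t : R).

(** F on the positive half-line is glued to 0 on the negative one. At 0 the difference quotient is
    dominated by that of F, which tends to F' 0 = 0. *)
Lemma is_derive_posfun F (F' : R -> R) :
  (forall t : R, 0 <= t -> is_derive t 1 F (F' t)) -> F 0 = 0 -> F' 0 = 0 ->
  forall t : R, is_derive t 1 (fun t => F (Num.max t 0)) (F' (Num.max t 0)).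
Proof.
move=> dF F0 F'0 t.
have [t0|[t0|t0]] : t < 0 \/ 0 < t \/ t = 0 by case: (ltgtP t 0) => ?; [left|right; left|right; right].
- have tE : \forall y \near t, cst 0 y = F (Num.max y 0).
    near=> y; rewrite /cst max_r ?F0//; apply: ltW; near: y; exact: lt_nbhsl.
  rewrite max_r ?ltW// F'0.
  exact: (near_eq_is_derive tE (is_derive_cst (0 : R) t (1 : R))).
- have tE : \forall y \near t, F y = F (Num.max y 0).
    near=> y; rewrite max_l//; apply: ltW; near: y; exact: lt_nbhsr.
  rewrite max_l ?ltW//.
  by apply: (near_eq_is_derive tE); apply: dF; rewrite ltW.
- rewrite t0 max_l//.
  have [F0d F0v] := dF 0 (lexx 0); rewrite F'0 in F0v *.
  have cv : h^-1 *: ((F \o shift 0) (h *: 1) - F 0) @[h --> 0^'] --> 'D_1 F 0.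
    exact: F0d.
  rewrite F0v in cv.
  suff cv' : h^-1 *: (((fun t => F (Num.max t 0)) \o shift 0) (h *: 1) -
      F (Num.max 0 0)) @[h --> 0^'] --> (0 : R).
    by split; [apply/cvg_ex; exists 0|exact: cvg_lim cv'].
  apply/cvgr0Pnorm_lt => e e0; move/cvgr0Pnorm_lt : cv => /(_ _ e0).
  apply: filterS => h; apply: le_lt_trans.
  rewrite /= !scaler1 !addr0 maxxx F0 !subr0 !normrM ler_wpM2l//.
  by case: (leP h 0) => h0; rewrite ?F0 ?normr0.
Unshelve. all: by end_near. Qed.

End positive_part_derivative.

Section truncation.
Context {R : realType} (d : R) (d0 : 0 < d).
Implicit Types s t x y : R.

(* F x is close to x for small d; the term d of the denominator makes F flat
   at 0 and the term d * x ^+ 2 makes F bounded. *)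
Let D x := d + x + d * x ^+ 2.
Let F x := x ^+ 2 * (D x)^-1.
Let q x := x / D x.
Let r x := (D x)^-1.
(** The derivative (x^2 + 2 d x) / (D x)^2 of F, written through [q] and [r], which are bounded and
    Lipschitz on the half-line. *)
Let F' x := q x ^+ 2 + 2 * d * q x * r x.

Let D_gt0 x : 0 <= x -> 0 < D x.
Proof. by move=> x0; rewrite /D -addrA ltr_pwDl// addr_ge0// mulr_ge0 ?sqr_ge0// ltW. Qed.

Let r_ge0 x : 0 <= x -> 0 <= r x.
Proof. by move=> x0; rewrite /r invr_ge0 ltW// D_gt0. Qed.

Let r_le x : 0 <= x -> r x <= d^-1.
Proof.
move=> x0; rewrite /r lef_pV2 ?posrE ?D_gt0//.
by rewrite /D -addrA lerDl addr_ge0// mulr_ge0 ?sqr_ge0// ltW.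
Qed.

Let q_ge0 x : 0 <= x -> 0 <= q x.
Proof. by move=> x0; rewrite mulr_ge0// r_ge0. Qed.

Let q_le1 x : 0 <= x -> q x <= 1.
Proof.
move=> x0; rewrite ler_pdivrMr ?D_gt0// mul1r /D.
have : 0 <= d * x ^+ 2 by rewrite mulr_ge0 ?sqr_ge0// ltW.
by move: (d0); lra.
Qed.

Let is_derive_F x : 0 <= x -> is_derive x 1 F (F' x).
Proof.
move=> x0; have D0 : D x != 0 by rewrite gt_eqF// D_gt0.
have dD : is_derive x 1 D (1 + 2 * d * x).
  have -> : D = (fun=> d) + id + d *: (id ^+ 2) by apply/funext => y.
  have dX1 := @is_deriveX R R id 2 x 1 1 (is_derive_id x 1).
  have dsum := is_deriveD (is_deriveD (is_derive_cst d x 1) (is_derive_id x 1))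
    (is_deriveZ d dX1).
  by apply: (is_derive_eq dsum); rewrite add0r expr1 /GRing.scale/=; ring.
have dV := is_deriveV D0 dD.
have dX : is_derive x 1 (fun y : R => y ^+ 2) (2 * x).
  have -> : (fun y : R => y ^+ 2) = id ^+ 2 by apply/funext.
  by apply: is_derive_eq; rewrite /= expr1 /GRing.scale/= mulr1 mulr_natl.
apply: (is_derive_eq (is_deriveM dX dV)); rewrite /GRing.scale /= /F' /q /r.
have xD : D x = d + x + d * x ^+ 2 by [].
move: D0; rewrite xD => D0; field.
by [].
Qed.

Let F'_ge0 x : 0 <= x -> 0 <= F' x.
Proof.
move=> x0; have := r_ge0 x0; have := q_ge0 x0 => q0 r0.
by rewrite addr_ge0 ?sqr_ge0// !mulr_ge0// ltW.
Qed.

(** Expanding (D x)^2 yields the numerator x^2 + 2 d x plus nonnegative terms. *)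
Let F'_le1 x : 0 <= x -> F' x <= 1.
Proof.
move=> x0; have D0 := D_gt0 x0; have D1 : D x != 0 by rewrite gt_eqF.
have -> : F' x = (x ^+ 2 + 2 * d * x) / (D x) ^+ 2.
  by rewrite /F' /q /r; field.
rewrite ler_pdivrMr ?exprn_gt0// mul1r /D.
have dge := ltW d0; have dx : 0 <= d * x by rewrite mulr_ge0.
have dx2 : 0 <= d * x ^+ 2 by rewrite mulr_ge0// sqr_ge0.
rewrite [leRHS](_ : _ = x ^+ 2 + 2 * d * x +
  (d ^+ 2 + 2 * (d + x) * (d * x ^+ 2) + (d * x ^+ 2) ^+ 2)); last by ring.
by rewrite lerDl !addr_ge0 ?sqr_ge0// mulr_ge0// mulr_ge0// addr_ge0.
Qed.

(** In the difference of the expressions through q and r, the function q has Lipschitz constant 1/d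
    + d and a cofactor of at most 4, while r has Lipschitz constant 1/d^2 + 2 and a cofactor of at
    most 2 d. *)
Let F'_lip x y : 0 <= x -> 0 <= y ->
  `|F' x - F' y| <= (4 * (d^-1 + d) + 2 * d * (d^-1 ^+ 2 + 2)) * `|x - y|.
Proof.
move=> x0 y0; have Dx : D x != 0 by rewrite gt_eqF ?D_gt0.
have Dy : D y != 0 by rewrite gt_eqF ?D_gt0.
have qE : q x - q y = (x - y) * (d * (r x * r y) - d * (q x * q y)).
  by move: Dx Dy; rewrite /q /r /D => Dx Dy; field; rewrite ?Dx ?Dy.
have rE : r x - r y = (y - x) * (r x * r y + d * (q x * r y) + d * (r x * q y)).
  by move: Dx Dy; rewrite /q /r /D => Dx Dy; field; rewrite ?Dx ?Dy.
have dge := ltW d0; have A0 : 0 <= d^-1 by rewrite invr_ge0.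
have dA : d * d^-1 = 1 by rewrite divff// gt_eqF.
have [qx0 qy0 qx1 qy1] : [/\ 0 <= q x, 0 <= q y, q x <= 1 & q y <= 1].
  by rewrite !q_ge0 ?q_le1.
have [rx0 ry0 rx1 ry1] : [/\ 0 <= r x, 0 <= r y, r x <= d^-1 & r y <= d^-1].
  by rewrite !r_ge0 ?r_le.
have rr : r x * r y <= d^-1 ^+ 2 by rewrite expr2 ler_pM.
have qq : q x * q y <= 1 by rewrite -[leRHS]mulr1 ler_pM.
have qr : q x * r y <= d^-1 by rewrite -[leRHS]mul1r ler_pM.
have rq : r x * q y <= d^-1 by rewrite -[leRHS]mulr1 ler_pM.
have qle : `|q x - q y| <= (d^-1 + d) * `|x - y|.
  rewrite qE normrM mulrC ler_wpM2r// ler_norml.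
  have drr : d * (r x * r y) <= d^-1.
    by apply: (le_trans (ler_wpM2l dge rr)); rewrite expr2 mulrA dA mul1r.
  have drr0 : 0 <= d * (r x * r y) by rewrite !mulr_ge0.
  have dqq : d * (q x * q y) <= d by rewrite -[leRHS]mulr1 ler_wpM2l.
  have dqq0 : 0 <= d * (q x * q y) by rewrite !mulr_ge0.
  by apply/andP; split; lra.
have rle : `|r x - r y| <= (d^-1 ^+ 2 + 2) * `|x - y|.
  rewrite rE normrM mulrC distrC ler_wpM2r// ger0_norm; last first.
    by rewrite !addr_ge0// !mulr_ge0.
  have : d * (q x * r y) <= 1 by rewrite -dA ler_wpM2l.
  have : d * (r x * q y) <= 1 by rewrite -dA ler_wpM2l.
  lra.
have -> : F' x - F' y = (q x - q y) * (q x + q y + 2 * d * r x) +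
    (2 * d * q y) * (r x - r y) by rewrite /F'; ring.
rewrite [leRHS]mulrDl (le_trans (ler_normD _ _))//; apply: lerD; rewrite normrM.
  rewrite -[leRHS]mulrA mulrC; apply: ler_pM => //.
  rewrite ger0_norm; last by rewrite !addr_ge0// !mulr_ge0.
  have : d * r x <= 1 by rewrite -dA ler_wpM2l.
  lra.
rewrite -[leRHS]mulrA; apply: ler_pM => //.
rewrite ger0_norm; last by rewrite !mulr_ge0.
by rewrite -[leRHS]mulr1 ler_wpM2l// mulr_ge0.
Qed.

Let b t := F (Num.max t 0).
Let b' t := F' (Num.max t 0).
Let L := 4 * (d^-1 + d) + 2 * d * (d^-1 ^+ 2 + 2).

Let max_ge0 t : 0 <= Num.max t 0. Proof. by rewrite le_max lexx orbT. Qed.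

Let is_derive_b (t : R) : is_derive t 1 b (b' t).
Proof.
apply: is_derive_posfun; first exact: is_derive_F.
- by rewrite /F expr0n/= mul0r.
- by rewrite /F' /q !mul0r expr0n/= !(mulr0, mul0r) addr0.
Qed.

Let b'_lip s t : `|b' s - b' t| <= L * `|s - t|.
Proof.
apply: (le_trans (F'_lip _ _)) => //; rewrite ler_wpM2l//.
  by rewrite addr_ge0 ?mulr_ge0 ?addr_ge0 ?invr_ge0 ?sqr_ge0// ltW.
have := ler_norm (s - t); have := ler_norm (t - s); rewrite distrC ler_norml.
by case: (leP s 0) => s0; case: (leP t 0) => t0 *; apply/andP; split; lra.
Qed.

Let F_ge0 x : 0 <= x -> 0 <= F x.
Proof. by move=> x0; rewrite mulr_ge0 ?sqr_ge0// r_ge0. Qed.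

Let F_le x : 0 <= x -> F x <= x.
Proof.
move=> x0; rewrite /F expr2 -mulrA -[leRHS]mulr1 ler_wpM2l//.
exact: q_le1.
Qed.

Let F_le_inv x : 0 <= x -> F x <= d^-1.
Proof.
move=> x0; rewrite /F ler_pdivrMr ?D_gt0// mulrC ler_pdivlMr// /D.
rewrite mulrC -[leLHS]add0r lerD//; move: (d0) x0; lra.
Qed.

Let F_ge x : 0 <= x -> x - F x <= d + d * x ^+ 2.
Proof.
move=> x0; have D0 := D_gt0 x0; have D1 : D x != 0 by rewrite gt_eqF.
rewrite [leLHS](_ : _ = q x * (d + d * x ^+ 2)); last first.
  by move: D1; rewrite /F /q /D => D1; field.
have dge := ltW d0; rewrite -[leRHS]mul1r; apply: ler_wpM2r; last exact: q_le1.
by rewrite addr_ge0// mulr_ge0 ?sqr_ge0.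
Qed.

Let F_eq0 x : 0 <= x -> F x = 0 -> x = 0.
Proof.
move=> x0 /eqP; rewrite mulf_eq0 expf_eq0/= => /orP[/eqP//|].
by rewrite invr_eq0 gt_eqF// D_gt0.
Qed.

(* An even C^1 truncation of |s|, vanishing for |s| <= d. *)
Definition trunc s := b (s - d) + b (- s - d).
Definition trunc' s := b' (s - d) - b' (- s - d).

Let max_sub_le s : Num.max (s - d) 0 + Num.max (- s - d) 0 <= `|s|.
Proof.
move: (d0) (ler_norm s) (ler_norm (- s)); rewrite normrN.
by case: (leP (s - d) 0) => ?; case: (leP (- s - d) 0) => ? *; lra.
Qed.

Lemma trunc_is_derive (s : R) : is_derive s 1 trunc (trunc' s).
Proof.
have d1 : is_derive s 1 (fun t : R => t - d) 1.
  by apply: is_derive_eq; rewrite subr0.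
have d2 : is_derive s 1 (fun t : R => - t - d) (- 1).
  by apply: is_derive_eq; rewrite subr0.
have e1 := @is_derive1_comp R b (fun t => t - d) s _ _ (is_derive_b (s - d)) d1.
have e2 := @is_derive1_comp R b (fun t => - t - d) s _ _ (is_derive_b (- s - d)) d2.
by apply: (is_derive_eq (is_deriveD e1 e2)); rewrite mulr1 mulrN1.
Qed.

Lemma trunc'_lip s t : `|trunc' s - trunc' t| <= 2 * L * `|s - t|.
Proof.
have h1 := b'_lip (s - d) (t - d); have h2 := b'_lip (- s - d) (- t - d).
have e1 : s - d - (t - d) = s - t by ring.
have e2 : - s - d - (- t - d) = t - s by ring.
rewrite e1 in h1; rewrite e2 (distrC t s) in h2.
rewrite /trunc'; move: (b' (s - d)) (b' (t - d)) (b' (- s - d)) (b' (- t - d)) h1 h2.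
move=> u v w z h1 h2; rewrite (_ : u - w - (v - z) = (u - v) + (z - w)); last by ring.
rewrite (le_trans (ler_normD _ _))// (_ : 2 * L * _ = L * `|s - t| + L * `|s - t|).
  by rewrite lerD// distrC.
by ring.
Qed.

Lemma trunc'_le1 s : `|trunc' s| <= 1.
Proof.
have B t : 0 <= b' t <= 1 by rewrite F'_ge0 ?F'_le1.
by rewrite ler_norml; have /andP[? ?] := B (s - d); have /andP[? ?] := B (- s - d);
  apply/andP; split; rewrite /trunc'; lra.
Qed.

Lemma trunc_ge0 s : 0 <= trunc s.
Proof. by rewrite addr_ge0// F_ge0. Qed.

Lemma trunc_le s : trunc s <= `|s|.
Proof. by apply: le_trans (max_sub_le s); rewrite lerD// F_le. Qed.

Lemma trunc_bounded s : trunc s <= 2 * d^-1.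
Proof. by rewrite mulr2n mulrDl !mul1r lerD// F_le_inv. Qed.

Lemma trunc_eq0 s : `|s| <= d -> trunc s = 0.
Proof.
rewrite ler_norml => /andP[ds sd].
rewrite /trunc /b !max_r; [|lra|lra].
by rewrite /F expr0n/= mul0r addr0.
Qed.

(** Both summands of [trunc] are nonnegative and F vanishes only at 0, where F' vanishes too. Hence
    the gradient T'(u) G is null wherever T(u) is, with no appeal to uniqueness of weak
    gradients. *)
Lemma trunc'_eq0 s : trunc s = 0 -> trunc' s = 0.
Proof.
move/eqP; rewrite paddr_eq0 ?F_ge0// => /andP[/eqP/F_eq0 bc /eqP/F_eq0 bd].
by rewrite /trunc' /b' bc// bd// subrr.
Qed.

(** One d is lost by the shift to s - d; the rest, d + d s^2, by passing from x to F x. For fixed s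
    the bound is linear in d, which gives the convergence to |s|. *)
Lemma trunc_ge s : `|s| - trunc s <= d * (2 + s ^+ 2).
Proof.
have key s' : 0 <= s' -> s' - b (s' - d) <= d * (2 + s' ^+ 2).
  move=> s0; have := F_ge (max_ge0 (s' - d)); rewrite /b.
  set x := Num.max _ 0 => Fx.
  have xs : s' - d <= x by rewrite le_max lexx.
  have x0 : 0 <= x by rewrite le_max lexx orbT.
  have : d * x ^+ 2 <= d * s' ^+ 2.
    rewrite ler_wpM2l ?ler_sqr// ?(ltW d0)// /x ge_max s0 andbT.
    by move: d0; lra.
  lra.
have [s0|s0] := leP 0 s.
  apply: le_trans (key _ s0); rewrite ger0_norm// lerD2l lerN2 /trunc lerDl.
  exact: F_ge0.
have s1 : 0 <= - s by lra.
rewrite ltr0_norm// -sqrrN; apply: le_trans (key _ s1).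
by rewrite lerD2l lerN2 /trunc lerDr F_ge0.
Qed.

End truncation.

Lemma trunc_cvg {R : realType} (s : R) :
  trunc (n.+1%:R^-1) s @[n --> \oo] --> `|s|.
Proof.
apply/cvgrPdist_le => e e0.
have cv : (fun n => n.+1%:R^-1 * (2 + s ^+ 2)) @ \oo --> (0 : R).
  by rewrite -[0 in X in _ --> X](mul0r (2 + s ^+ 2)); apply: cvgM; [exact: cvg_harmonic|exact: cvg_cst].
move/cvgrPdist_le : cv => /(_ _ e0); apply: filterS => n.
have n0 : 0 < n.+1%:R^-1 :> R by [].
rewrite sub0r normrN => h; rewrite ger0_norm ?subr_ge0 ?trunc_le//.
apply: (le_trans (trunc_ge n0 s)); apply: le_trans h; exact: ler_norm.
Qed.

(** * Integration by parts *)

Lemma continuous_measurable_cara {R : realType} {n : nat}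
    (mu : {outer_measure set 'rV[R]_n -> \bar R})
    (D : set (caratheodory_type mu)) (f : 'rV[R]_n -> R) :
  (forall A : set 'rV[R]_n, open A -> mu.-caratheodory A) ->
  continuous f -> measurable_fun D (f : caratheodory_type mu -> R).
Proof.
move=> om cf mD; apply: (measurability _ (RGenOInfty.measurableE R)) => //.
move=> /= _ [_ [a ->]] <-.
apply: (@measurableI _ (caratheodory_type mu)) => //; apply: om.
by apply: open_comp => // x _; exact: cf.
Qed.

Lemma integral_preserving d (T : measurableType d) (R : realType)
    (mu : {measure set T -> \bar R}) (phi : T -> T) (mphi : measurable_fun setT phi)
    (f : T -> \bar R) :
  (forall A, measurable A -> mu (phi @^-1` A) = mu A) ->
  measurable_fun setT f ->
  (\int[mu]_x f (phi x) = \int[mu]_x f x)%E.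
Proof.
move=> muphi mf; rewrite integralE [RHS]integralE.
rewrite -(ge0_integral_preserving mphi muphi (measurable_funepos mf) (funepos_ge0 f)).
rewrite -(ge0_integral_preserving mphi muphi (measurable_funeneg mf) (funeneg_ge0 f)).
by congr (_ - _)%E; apply: eq_integral => x _; rewrite ?funeposE ?funenegE.
Qed.

Lemma indic_integrable d (T : measurableType d) (R : realType)
    (mu : {measure set T -> \bar R}) (D K : set T) (M : R) :
  measurable D -> measurable K -> (mu K < +oo)%E ->
  mu.-integrable D (fun x => (M * \1_K x)%:E).
Proof.
move=> mD mK Koo; under [X in _.-integrable _ X]eq_fun do rewrite EFinM.
apply: integrableZl => //; apply: (integrableS measurableT) => //.
apply/integrableP; split; first by apply/measurable_EFinP; exact: measurable_indic.
rewrite (eq_integral (fun x => (\1_K x)%:E)); last first.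
  by move=> x _; rewrite gee0_abs// lee_fin.
by rewrite integral_indic// setIT.
Qed.

Lemma bounded_support_integrable d (T : measurableType d) (R : realType)
    (mu : {measure set T -> \bar R}) (D K : set T) (f : T -> R) (M : R) :
  measurable D -> measurable K -> (mu K < +oo)%E -> measurable_fun D f ->
  (forall x, D x -> ~ K x -> f x = 0) -> (forall x, D x -> `|f x| <= M) ->
  mu.-integrable D (EFin \o f).
Proof.
move=> mD mK Koo mf f0 fM; apply: (@le_integrable _ _ _ mu D mD _ (fun x => (`|M| * \1_K x)%:E)).
- exact/measurable_EFinP.
- move=> x Dx /=; rewrite lee_fin indicE; have [/set_mem Kx|/negP Kx] := boolP (x \in K).
    by rewrite mulr1 normr_id (le_trans (fM x Dx))// ler_norm.
  by rewrite f0 ?normr0// => Kx'; apply: Kx; rewrite inE.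
- exact: indic_integrable.
Qed.

Section integration_by_parts.
Context {R : realType} {n : nat}.
Local Notation LT := (caratheodory_type (@lebesgue_outer R n)).
Implicit Types (f w phi : 'rV[R]_n -> R) (K : set 'rV[R]_n) (i : 'I_n).

Lemma continuous_measurable_leb (D : set LT) f :
  continuous f -> measurable_fun D (f : LT -> R).
Proof. by apply: continuous_measurable_cara => A; exact: open_measurable_leb. Qed.

Lemma compact_measurable_leb K : compact K -> measurable (K : set LT).
Proof.
move=> cK; rewrite -[K]setCK; apply: measurableC; apply: open_measurable_leb.
by apply: closed_openC; apply: compact_closed => //; exact: norm_hausdorff.
Qed.

Lemma compact_leb_lty K : compact K -> (leb n K < +oo)%E.
Proof. by move=> cK; apply: leb_bounded; exact: compact_bounded. Qed.

Lemma compact_support_bounded K f : compact K -> continuous f ->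
  (forall x, ~ K x -> f x = 0) -> exists2 M, 0 <= M & forall x, `|f x| <= M.
Proof.
move=> cK cf f0; have cabs : continuous (fun x => `|f x|).
  by move=> x; apply: (@continuous_comp _ _ _ f Num.norm); [exact: cf|exact: norm_continuous].
have [K0|/set0P K0] := eqVneq K set0.
  by exists 0 => // x; rewrite f0 ?normr0// K0.
have [c _ fc] := @EVT_max_rV R n (fun x => `|f x|) K K0 cK (continuous_subspaceT cabs).
exists `|f c| => // x; have [Kx|Kx] := pselect (K x); first by apply: fc; rewrite inE.
by rewrite f0 ?normr0.
Qed.

Lemma compact_support_integrable (D : set LT) K f : measurable D -> compact K ->
  continuous f -> (forall x, ~ K x -> f x = 0) ->
  (leb n).-integrable D (EFin \o f).
Proof.
move=> mD cK cf f0; have [M _ fM] := compact_support_bounded cK cf f0.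
apply: (@bounded_support_integrable _ LT R (leb n) D K f M) => //.
- exact: compact_measurable_leb.
- exact: compact_leb_lty.
- exact: continuous_measurable_leb.
- by move=> x _; exact: f0.
Qed.

(* Difference quotients have zero integral by translation invariance. *)
Lemma integral_partial_eq0 w K i : C1 w -> compact K ->
  (forall x, ~ K x -> w x = 0) -> (\int[leb n]_x (partial i w x)%:E = 0)%E.
Proof.
move=> Cw cK w0; have cw := C1_continuous Cw.
have [_ cdw] := Cw i.
have clK : closed K by apply: compact_closed => //; exact: norm_hausdorff.
have dw0 : forall x, ~ K x -> partial i w x = 0 by exact: partial_eq0.
have [M M0 dwM] := compact_support_bounded cK cdw dw0.
have [r r0 Kr] := bounded_set_box (compact_bounded cK).
pose e : 'rV[R]_n := delta_mx ord0 i.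
pose h k : R := k.+1%:R^-1.
have h0 k : 0 < h k by rewrite invr_gt0.
have h1 k : h k <= 1 by rewrite invf_le1// ler1n.
pose F k (x : LT) : \bar R := ((h k)^-1 * (w (x + h k *: e) - w x))%:E.
(* Since h k <= 1, this box contains the supports of w and of all its translates. With the mean
   value theorem it provides the integrable bound M times the indicator of B. *)
pose B : set 'rV[R]_n := box (const_mx (- r - 1)) (const_mx (r + 1)).
have wshift k : continuous (fun x : 'rV[R]_n => w (x + h k *: e)).
  move=> x; apply: (@continuous_comp _ _ _ (fun x : 'rV[R]_n => x + h k *: e) w); last exact: cw.
  exact: (@continuousD _ _ _ (id : 'rV[R]_n -> 'rV[R]_n) (cst (h k *: e)) x
    (fun _ h => h) (@cst_continuous _ _ _ x)).
have KB (x : 'rV[R]_n) (t : R) : `|t| <= 1 -> K (x + t *: e) -> B x.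
  move=> t1 /Kr xr j; have := xr j; rewrite !mxE eqxx/=.
  move: t1; rewrite ler_norml => /andP[t1 t2].
  case: (j == i); rewrite ?mulr1 ?mulr0 ?addr0 => /andP[? ?]; apply/andP; split; lra.
have mF k : measurable_fun setT (F k).
  apply/measurable_EFinP; apply: measurable_funM; first exact: measurable_cst.
  by apply: measurable_funB; apply: continuous_measurable_leb.
have FB k (x : LT) : setT x -> (`|F k x| <= (M * \1_B x)%:E)%E.
  move=> _; rewrite /F /= lee_fin indicE.
  have [/set_mem Bx|/negP Bx] := boolP (x \in B).
    have [|t _ ->] := @is_derive_mvt _ _ w x e (h k).
      by move=> t; have [] := Cw i.
    by rewrite mulrA mulVf ?gt_eqF// mul1r mulr1; exact: dwM.
  rewrite mulr0 !w0 ?subrr ?mulr0 ?normr0//.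
    by move=> Kx; apply: Bx; rewrite inE; apply: (KB x 0); rewrite ?normr0// scale0r addr0.
  by move=> Kx; apply: Bx; rewrite inE; apply: (KB x (h k)); rewrite ?gtr0_norm.
have Fcvg (x : LT) : setT x -> F ^~ x @ \oo --> (partial i w x)%:E.
  move=> _; apply/fine_cvgP; split; first exact: nearW.
  have [/(_ x) dx _] := Cw i.
  have hcvg : h @ \oo --> (0 : R)^'.
    move=> A; rewrite /dnbhs /within /= => A0.
    have : \forall k \near \oo, h k != 0 -> A (h k) by exact: (@cvg_harmonic R _ A0).
    by rewrite nbhs_simpl; apply: filterS => k; apply; rewrite gt_eqF.
  have := cvg_comp _ _ hcvg dx; apply: cvg_trans.
  by apply: near_eq_cvg; apply: nearW => k /=; rewrite [_ + x]addrC.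
have mB : measurable (B : set LT) by exact: box_measurable.
have Boo : (leb n B < +oo)%E.
  by apply: compact_leb_lty; exact: box_compact.
have iB : (leb n).-integrable setT (fun x => (M * \1_B x)%:E).
  exact: indic_integrable.
have mdw : measurable_fun setT (fun x : LT => (partial i w x)%:E).
  by apply/measurable_EFinP; exact: continuous_measurable_leb.
have [_ _ Fint] := dominated_convergence measurableT mF mdw
  (aeW _ Fcvg) iB (aeW _ (fun x k => FB k x)).
have iw : (leb n).-integrable setT (EFin \o w) by exact: compact_support_integrable w0.
have iws k : (leb n).-integrable setT (EFin \o (fun x => w (x + h k *: e))).
  have [M' _ wM'] := compact_support_bounded cK cw w0.
  apply: (@bounded_support_integrable _ LT R (leb n) setT B (fun x => w (x + h k *: e)) M').
  - exact: measurableT.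
  - exact: mB.
  - exact: Boo.
  - exact: (@continuous_measurable_leb setT (fun x => w (x + h k *: e)) (wshift k)).
  - move=> x _ Bx; apply: w0 => Kx; apply: Bx; apply: (KB x (h k)) => //.
    by rewrite gtr0_norm.
  - by move=> x _; exact: wM'.
have F0 k : (\int[leb n]_x F k x = 0)%E.
  rewrite /F; under eq_integral do rewrite EFinM EFinB.
  rewrite integralZl//; last exact: (integrableB measurableT (iws k) iw).
  rewrite integralB//.
  rewrite (@integral_preserving _ _ _ (leb n) (fun x : LT => x + h k *: e)
    (measurable_shift (h k *: e) (D := setT)) (EFin \o w)).
  - by rewrite subee ?mule0//; exact: integrable_fin_num.
  - by move=> A _; exact: leb_shift.
  - by apply/measurable_EFinP; exact: continuous_measurable_leb.
  - exact: (iws k).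
transitivity (limn (fun k => (\int[leb n]_x F k x)%E)).
  by apply/esym/cvg_lim => //; exact: Fint.
by under eq_fun do rewrite F0; exact: lim_cst.
Qed.

(** The product f phi is C^1 with support in K, so its partial derivative integrates to 0 over the
    whole space, and the integrands vanish outside U. *)
Lemma integration_by_parts_C1 (U : set LT) f phi K i : measurable U ->
  C1 f -> C1 phi -> compact K -> K `<=` U -> (forall x, ~ K x -> phi x = 0) ->
  \int[leb n]_(x in U) (f x * partial i phi x) =
  - \int[leb n]_(x in U) (partial i f x * phi x).
Proof.
move=> mU Cf Cphi cK KU phi0.
have cf := C1_continuous Cf; have cphi := C1_continuous Cphi.
have [_ cdf] := Cf i; have [_ cdphi] := Cphi i.
have clK : closed K by apply: compact_closed => //; exact: norm_hausdorff.
have dphi0 : forall x, ~ K x -> partial i phi x = 0 by exact: partial_eq0.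
have [Cw dw] := C1M Cf Cphi.
have c1 : continuous (f \* partial i phi) by move=> x; exact: (continuousM (cf x) (cdphi x)).
have c2 : continuous (phi \* partial i f) by move=> x; exact: (continuousM (cphi x) (cdf x)).
have i1 D : measurable D -> (leb n).-integrable (D : set LT) (EFin \o (f \* partial i phi)).
  move=> mD; apply: (@compact_support_integrable _ K) => // x Kx /=.
  by rewrite dphi0// mulr0.
have i2 D : measurable D -> (leb n).-integrable (D : set LT) (EFin \o (phi \* partial i f)).
  move=> mD; apply: (@compact_support_integrable _ K) => // x Kx /=.
  by rewrite phi0// mul0r.
have /= := @integral_partial_eq0 (f \* phi) K i Cw cK.
rewrite dw => /(_ _)/(congr1 fine) /= intw.
have {}intw : \int[leb n]_(x in U) ((f \* partial i phi) x + (phi \* partial i f) x) = 0.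
  rewrite -[RHS]intw; last by move=> x Kx; rewrite phi0// mulr0.
  rewrite Rintegral_mkcond; congr fine; apply: eq_integral => x _ /=.
  rewrite patchE; case: ifPn => // /negP Ux; rewrite dphi0 ?phi0 ?mulr0 ?mul0r ?addr0//.
    by move=> Kx; apply: Ux; rewrite inE; exact: KU.
  by move=> Kx; apply: Ux; rewrite inE; exact: KU.
apply/eqP; rewrite -addr_eq0 -[X in _ == X]intw RintegralD//; [|exact: i1|exact: i2].
by rewrite eq_sym; apply/eqP; congr (_ + _); apply: eq_Rintegral => x _; rewrite mulrC.
Qed.

End integration_by_parts.

(** * Integrals of powers *)

Section power_integrals.
Local Open Scope ereal_scope.
Context d (T : measurableType d) (R : realType).
Variables (mu : {measure set T -> \bar R}) (p : R).
Hypothesis p1 : (1 <= p)%R.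
Implicit Types (D E K : set T) (a b g w : T -> R).

Let p0 : (0 < p)%R. Proof. exact: lt_le_trans p1. Qed.
Let p_ge0 : (0 <= p)%R. Proof. exact: ltW. Qed.

Lemma ge0_cvge0P (e : nat -> \bar R) : (forall k, 0 <= e k) ->
  e @ \oo --> 0 <-> forall r : R, (0 < r)%R -> \forall k \near \oo, e k <= r%:E.
Proof.
move=> e0; split=> [ecvg r r0|ecvg].
  have r0' : 0 < r%:E by rewrite lte_fin.
  have /fine_cvgP[efin /cvgrPdist_le/(_ _ r0)] := ecvg.
  move=> ef; near=> k.
  have kfin : e k \is a fin_num by near: k.
  rewrite -(fineK kfin) lee_fin.
  have : (`|0 - fine (e k)| <= r)%R by near: k.
  by rewrite sub0r normrN; apply: le_trans; exact: ler_norm.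
apply/fine_cvgP; split.
  have := ecvg _ ltr01; apply: filterS => k ek.
  by rewrite ge0_fin_numE// (le_lt_trans ek)// ltry.
apply/cvgrPdist_le => r r0; have := ecvg _ r0; apply: filterS => k ek /=.
have kfin : e k \is a fin_num by rewrite ge0_fin_numE// (le_lt_trans ek)// ltry.
by rewrite sub0r normrN ger0_norm ?fine_ge0// -lee_fin fineK.
Unshelve. all: by end_near. Qed.

Lemma measurable_pow D a : measurable_fun D a ->
  measurable_fun D (fun x => (a x `^ p)%:E).
Proof.
move=> ma; apply/measurable_EFinP.
by apply: (measurableT_comp (@measurable_powR R p)) => //.
Qed.

Lemma le_int_pow D a b : measurable D -> measurable_fun D a -> measurable_fun D b ->
  (forall x, D x -> (0 <= a x <= b x)%R) ->
  \int[mu]_(x in D) (a x `^ p)%:E <= \int[mu]_(x in D) (b x `^ p)%:E.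
Proof.
move=> mD ma mb ab; apply: ge0_le_integral => //; try exact: measurable_pow.
- by move=> x _; rewrite lee_fin powR_ge0.
- move=> x /ab/andP[a0 axb]; rewrite lee_fin ge0_ler_powR ?nnegrE//.
  exact: le_trans axb.
Qed.

Lemma int_powZ D (k : R) a : measurable D -> measurable_fun D a ->
  (0 <= k)%R -> (forall x, D x -> 0 <= a x)%R ->
  \int[mu]_(x in D) ((k * a x) `^ p)%:E = (k `^ p)%:E * \int[mu]_(x in D) (a x `^ p)%:E.
Proof.
move=> mD ma k0 a0; rewrite -ge0_integralZl//; last 3 first.
- exact: measurable_pow.
- by move=> x _; rewrite lee_fin powR_ge0.
- by rewrite lee_fin powR_ge0.
by apply: eq_integral => x /[!inE] Dx; rewrite powRM ?EFinM// a0.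
Qed.

(** The sum is at most twice the larger term; this needs monotonicity of the power and no
    convexity. *)
Lemma powRD_le (x y : R) : (0 <= x)%R -> (0 <= y)%R ->
  ((x + y) `^ p <= 2 `^ p * (x `^ p + y `^ p))%R.
Proof.
move=> x0 y0.
have key (s t : R) : (0 <= s)%R -> (s <= t)%R ->
    ((s + t) `^ p <= 2 `^ p * (s `^ p + t `^ p))%R.
  move=> s0 st; have t0 := le_trans s0 st.
  apply: (@le_trans _ _ ((2 * t) `^ p)%R).
    by rewrite ge0_ler_powR ?nnegrE ?addr_ge0 ?mulr_ge0//; lra.
  by rewrite powRM// ler_wpM2l ?powR_ge0// lerDr powR_ge0.
have [xy|/ltW yx] := leP x y; first exact: key.
by rewrite addrC [X in (_ * X)%R]addrC key.
Qed.

Lemma int_powD_le D a b : measurable D -> measurable_fun D a -> measurable_fun D b ->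
  (forall x, D x -> 0 <= a x)%R -> (forall x, D x -> 0 <= b x)%R ->
  \int[mu]_(x in D) ((a x + b x) `^ p)%:E <=
  (2 `^ p)%:E * (\int[mu]_(x in D) (a x `^ p)%:E + \int[mu]_(x in D) (b x `^ p)%:E).
Proof.
move=> mD ma mb a0 b0; rewrite -ge0_integralD//; last 4 first.
- by move=> x _; rewrite lee_fin powR_ge0.
- exact: measurable_pow.
- by move=> x _; rewrite lee_fin powR_ge0.
- exact: measurable_pow.
have mab : measurable_fun D (fun x => (a x `^ p)%:E + (b x `^ p)%:E).
  by apply: emeasurable_funD; exact: measurable_pow.
have ab0 x : D x -> 0 <= (a x `^ p)%:E + (b x `^ p)%:E.
  by rewrite -EFinD lee_fin addr_ge0 ?powR_ge0.
have c0 : 0 <= (2 `^ p)%:E :> \bar R by rewrite lee_fin powR_ge0.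
rewrite -(ge0_integralZl mu mD mab ab0 c0).
apply: ge0_le_integral => //.
- by move=> x _; rewrite lee_fin powR_ge0.
- by apply: measurable_pow; exact: measurable_funD.
- exact: measurable_funeM.
- by move=> x Dx; rewrite -EFinD -EFinM lee_fin powRD_le ?a0 ?b0.
Qed.

Lemma int_pow_cvg0_le D (k : R) (a b : nat -> T -> R) : measurable D ->
  (forall j, measurable_fun D (a j)) -> (forall j, measurable_fun D (b j)) ->
  (0 <= k)%R -> (forall j x, D x -> 0 <= a j x <= k * b j x)%R ->
  (forall j x, D x -> 0 <= b j x)%R ->
  \int[mu]_(x in D) (b j x `^ p)%:E @[j --> \oo] --> 0 ->
  \int[mu]_(x in D) (a j x `^ p)%:E @[j --> \oo] --> 0.
Proof.
move=> mD ma mb k0 ab b0 bcvg.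
apply: (@squeeze_cvge _ _ _ _ (cst 0) _
  (fun j => (k `^ p)%:E * \int[mu]_(x in D) (b j x `^ p)%:E)); last first.
- rewrite -[X in _ --> X](mule0 (k `^ p)%:E).
  by apply: cvgeZl.
- exact: cvg_cst.
- apply: nearW => j; apply/andP; split.
    by apply: integral_ge0 => x _; rewrite lee_fin powR_ge0.
  rewrite -int_powZ//; last by move=> x; exact: b0.
  apply: le_int_pow => //; last by move=> x; exact: ab.
  by apply: measurable_funM.
Qed.

Lemma int_pow_cvg0D D (a b : nat -> T -> R) : measurable D ->
  (forall j, measurable_fun D (a j)) -> (forall j, measurable_fun D (b j)) ->
  (forall j x, D x -> 0 <= a j x)%R -> (forall j x, D x -> 0 <= b j x)%R ->
  \int[mu]_(x in D) (a j x `^ p)%:E @[j --> \oo] --> 0 ->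
  \int[mu]_(x in D) (b j x `^ p)%:E @[j --> \oo] --> 0 ->
  \int[mu]_(x in D) ((a j x + b j x) `^ p)%:E @[j --> \oo] --> 0.
Proof.
move=> mD ma mb a0 b0 acvg bcvg.
apply: (@squeeze_cvge _ _ _ _ (cst 0) _
  (fun j => (2 `^ p)%:E * (\int[mu]_(x in D) (a j x `^ p)%:E +
                          \int[mu]_(x in D) (b j x `^ p)%:E))); last first.
- rewrite -[X in _ --> X](mule0 (2 `^ p)%:E) -[X in _ * X](adde0 0).
  apply: cvgeZl; first by [].
  have := cvgeD _ acvg bcvg; exact.
- exact: cvg_cst.
- apply: nearW => j; apply/andP; split.
    by apply: integral_ge0 => x _; rewrite lee_fin powR_ge0.
  by apply: int_powD_le => // x; [exact: a0|exact: b0].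
Qed.

Lemma measurable_excess D g (k : R) : measurable_fun D g ->
  measurable_fun D (fun x => g x - Num.min (g x) k)%R.
Proof. by move=> mg; apply: measurable_funB => //; exact: measurable_minr. Qed.

(** At each point the excess over level k is 0 once k passes g x, and it is dominated by g. *)
Lemma int_pow_excess_cvg0 D g : measurable D -> measurable_fun D g ->
  (forall x, D x -> 0 <= g x)%R -> \int[mu]_(x in D) (g x `^ p)%:E < +oo ->
  \int[mu]_(x in D) ((g x - Num.min (g x) k%:R) `^ p)%:E @[k --> \oo] --> 0.
Proof.
move=> mD mg g0 goo.
have mpow (k : nat) := measurable_pow (measurable_excess k%:R mg).
have cvg_ae : {ae mu, forall x, D x ->
    ((g x - Num.min (g x) k%:R) `^ p)%:E @[k --> \oo] --> 0}.
  apply: aeW => x Dx; apply: cvg_near_cst.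
  exists (Num.bound (g x)) => // k /= gk.
  rewrite min_l ?subrr ?powR0 ?gt_eqF//.
  apply: (@le_trans _ _ (Num.bound (g x))%:R); last by rewrite ler_nat.
  by rewrite ltW// archi_boundP// g0.
have ig : mu.-integrable D (fun x => (g x `^ p)%:E).
  apply/integrableP; split; first exact: measurable_pow.
  rewrite (eq_integral (fun x => (g x `^ p)%:E))// => x _.
  by rewrite gee0_abs// lee_fin powR_ge0.
have bound : {ae mu, forall x (k : nat), D x ->
    `|((g x - Num.min (g x) k%:R) `^ p)%:E| <= (g x `^ p)%:E}.
  apply: aeW => x k Dx; rewrite gee0_abs ?lee_fin ?powR_ge0//.
  have gx := g0 x Dx; rewrite ge0_ler_powR ?nnegrE ?subr_ge0 ?ge_min ?lexx//.
  by rewrite gerBl le_min gx ler0n.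
have [_ _] := dominated_convergence mD mpow (measurable_cst (0 : \bar R)) cvg_ae ig bound.
by rewrite integral0.
Qed.

(* The factors a_j are bounded and small where w_j is small, so only the part
   of g above a large level escapes the convergence of w_j. *)
Lemma int_pow_cvg0M D (L : R) g (a w : nat -> T -> R) : measurable D ->
  measurable_fun D g -> (forall j, measurable_fun D (a j)) ->
  (forall j, measurable_fun D (w j)) -> (0 <= L)%R ->
  (forall x, D x -> 0 <= g x)%R -> (forall j x, D x -> 0 <= w j x)%R ->
  (forall j x, D x -> 0 <= a j x <= 2)%R ->
  (forall j x, D x -> a j x <= L * w j x)%R ->
  \int[mu]_(x in D) (g x `^ p)%:E < +oo ->
  \int[mu]_(x in D) (w j x `^ p)%:E @[j --> \oo] --> 0 ->
  \int[mu]_(x in D) ((a j x * g x) `^ p)%:E @[j --> \oo] --> 0.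
Proof.
move=> mD mg ma mw L0 g0 w0 a2 aL goo wcvg.
have tail := int_pow_excess_cvg0 mD mg g0 goo.
pose gk (k : nat) x := (g x - Num.min (g x) k%:R)%R.
have mgk (k : nat) : measurable_fun D (gk k) := measurable_excess k%:R mg.
have gk0 k x : (0 <= gk k x)%R by rewrite /gk subr_ge0 ge_min lexx.
apply/ge0_cvge0P => [j|r r0].
  by apply: integral_ge0 => x _; rewrite lee_fin powR_ge0.
pose c := (2 `^ p : R)%R.
have c0 : (0 < c)%R by rewrite powR_gt0.
have c1 : c != 0%R by rewrite gt_eqF.
(* One factor c comes from the p-th power of a sum, the other from the factor 2 in front of the
   excess; the two parts then contribute r/2 each. *)
have r1 : (0 < r / (c * c * 2))%R by rewrite divr_gt0 ?mulr_gt0.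
have [N _ tailN] : \forall k \near \oo,
    \int[mu]_(x in D) (gk k x `^ p)%:E <= (r / (c * c * 2))%:E.
  move/ge0_cvge0P : tail; apply => // k; apply: integral_ge0 => x _.
  by rewrite lee_fin powR_ge0.
have {}tailN := tailN N (leqnn N).
have r2 : (0 < r / (c * 2))%R by rewrite divr_gt0 ?mulr_gt0.
have mwj j : measurable_fun D (fun x => L * N%:R * w j x)%R.
  by apply: measurable_funM => //; exact: measurable_cst.
have mgN : measurable_fun D (fun x => 2 * gk N x)%R.
  by apply: measurable_funM => //; exact: measurable_cst.
have LN : (0 <= L * N%:R)%R by rewrite mulr_ge0.
have : \int[mu]_(x in D) ((L * N%:R * w j x) `^ p)%:E @[j --> \oo] --> 0.
  apply: (int_pow_cvg0_le mD mwj mw LN _ w0 wcvg) => j x Dx.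
  by rewrite lexx mulr_ge0// w0.
rewrite ge0_cvge0P => [/(_ _ r2)|j]; last first.
  by apply: integral_ge0 => x _; rewrite lee_fin powR_ge0.
apply: filterS => j wj.
(* The bound a_j <= 2 is used on the excess of g over N, the bound a_j <= L w_j on the remaining
   part, which is at most N. *)
apply: (@le_trans _ _ (\int[mu]_(x in D) ((2 * gk N x + L * N%:R * w j x) `^ p)%:E)).
  apply: le_int_pow => //.
  - exact: measurable_funM.
  - exact: measurable_funD.
  - move=> x Dx; have /andP[aj0 aj2] := a2 j x Dx; have gx := g0 x Dx.
    rewrite mulr_ge0//= -{1}(subrK (Num.min (g x) N%:R) (g x)) mulrDr lerD//.
      by rewrite ler_wpM2r// gk0.
    apply: (@le_trans _ _ (L * w j x * N%:R)%R); last by rewrite mulrAC.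
    by apply: ler_pM => //; [rewrite le_min gx ler0n|exact: aL|rewrite ge_min lexx orbT].
apply: (le_trans (int_powD_le mD mgN (mwj j) _ _)).
- by move=> x _; rewrite mulr_ge0.
- by move=> x Dx; rewrite mulr_ge0// w0.
rewrite int_powZ// -/c.
apply: (@le_trans _ _ (c%:E * (c%:E * (r / (c * c * 2))%:E + (r / (c * 2))%:E))).
  apply: lee_wpmul2l; first by rewrite lee_fin ltW.
  by apply: leeD => //; apply: lee_wpmul2l => //; rewrite lee_fin ltW.
rewrite -!EFinM lee_fin le_eqVlt; apply/orP; left; apply/eqP.
by field.
Qed.

(** L^p convergence on a set of finite measure gives convergence of integrals against a bounded
    function. A pointwise inequality of Young type takes the place of Hölder's inequality. *)
Lemma cvg_Rintegral_mul K (C : R) (u : T -> R) (v : nat -> T -> R) (h : T -> R) :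
  measurable K -> mu K < +oo -> (0 <= C)%R -> measurable_fun K u ->
  (forall j, measurable_fun K (v j)) -> (forall x, K x -> `|h x| <= C)%R ->
  mu.-integrable K (fun x => (u x * h x)%:E) ->
  (forall j, mu.-integrable K (fun x => (v j x * h x)%:E)) ->
  \int[mu]_(x in K) (`|v j x - u x| `^ p)%:E @[j --> \oo] --> 0 ->
  (\int[mu]_(x in K) (v j x * h x))%R @[j --> \oo] --> (\int[mu]_(x in K) (u x * h x))%R.
Proof.
move=> mK Koo C0 mu_ mv hC iu iv vu.
have Kfin : mu K \is a fin_num by rewrite ge0_fin_numE.
apply/cvgrPdist_le => e e0.
pose M := (fine (mu K) + 1)%R.
have M0 : (0 < M)%R by rewrite ltr_wpDl// fine_ge0.
(* With this t and the s below, t M and t^(1-p) s both equal e / (2 (C + 1)), so the total error is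
   e C / (C + 1). Adding 1 to C and to the measure of K keeps the denominators positive. *)
pose t := (e / (2 * (C + 1) * M))%R.
have C1 : (0 < C + 1)%R by rewrite ltr_wpDl.
have t0 : (0 < t)%R by rewrite divr_gt0// !mulr_gt0.
pose s := (e / (2 * (C + 1) * t `^ (1 - p)))%R.
have tp : (0 < t `^ (1 - p))%R by rewrite powR_gt0.
have s0 : (0 < s)%R by rewrite divr_gt0// !mulr_gt0.
(* Either z <= t, or z = z^(1-p) z^p with z^(1-p) <= t^(1-p), the exponent 1 - p being
   nonpositive. *)
have young (z : R) : (0 <= z)%R -> (z <= t + t `^ (1 - p) * z `^ p)%R.
  move=> z0; have [zt|tz] := leP z t.
    by rewrite (le_trans zt)// lerDl mulr_ge0 ?powR_ge0.
  have z1 : (0 < z)%R by exact: lt_trans tz.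
  apply: (@le_trans _ _ (t `^ (1 - p) * z `^ p)%R); last by rewrite lerDr ltW.
  apply: (@le_trans _ _ (z `^ (1 - p) * z `^ p)%R).
    by rewrite -powRD ?subrK ?powRr1// ?gt_eqF ?implybT.
  rewrite ler_wpM2r ?powR_ge0//.
  have -> : (1 - p = - (p - 1))%R by rewrite opprB.
  rewrite !powRN lef_pV2 ?posrE ?powR_gt0//.
  by rewrite ge0_ler_powR ?nnegrE ?subr_ge0// ltW.
move: vu; rewrite ge0_cvge0P => [/(_ _ s0)|j]; last first.
  by apply: integral_ge0 => x _; rewrite lee_fin powR_ge0.
apply: filterS => j vs.
rewrite -(RintegralB mK iu (iv j)).
have idiff : mu.-integrable K (EFin \o (fun x => u x * h x - v j x * h x)%R).
  by have := integrableB mK iu (iv j).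
have [midiff _] := integrableP _ _ _ idiff.
rewrite -lee_fin (EFin_normr_Rintegral mK idiff).
apply: (le_trans (le_abse_integral mu mK midiff)).
have mvu : measurable_fun K (fun x => `|v j x - u x|)%R.
  by apply: measurableT_comp => //; exact: measurable_funB.
have mpow := measurable_pow mvu.
have mrhs : measurable_fun K (fun x => t%:E + (t `^ (1 - p))%:E * (`|v j x - u x| `^ p)%:E).
  by apply: emeasurable_funD => //; exact: measurable_funeM.
have rhs0 x : K x -> 0 <= t%:E + (t `^ (1 - p))%:E * (`|v j x - u x| `^ p)%:E.
  by move=> _; rewrite adde_ge0 ?mule_ge0 ?lee_fin ?powR_ge0// ltW.
apply: (@le_trans _ _ (\int[mu]_(x in K)
    (C%:E * (t%:E + (t `^ (1 - p))%:E * (`|v j x - u x| `^ p)%:E)))).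
  apply: ge0_le_integral => //.
  - exact: measurableT_comp.
  - exact: measurable_funeM.
  - move=> x Kx /=; rewrite -!EFinM lee_fin -mulrBl normrM mulrC.
    by apply: ler_pM => //; [exact: hC|rewrite distrC young].
have pow0 x : K x -> 0 <= (`|v j x - u x| `^ p)%:E by rewrite lee_fin powR_ge0.
have k0 : 0 <= (t `^ (1 - p))%:E by rewrite lee_fin powR_ge0.
have t0' x : K x -> 0 <= t%:E :> \bar R by rewrite lee_fin ltW.
have kpow0 x : K x -> 0 <= (t `^ (1 - p))%:E * (`|v j x - u x| `^ p)%:E.
  by move=> Kx; rewrite mule_ge0// pow0.
have C0' : 0 <= C%:E by rewrite lee_fin.
rewrite (ge0_integralZl mu mK mrhs rhs0 C0').
rewrite (ge0_integralD mu mK t0' (measurable_cst _) kpow0 (measurable_funeM _ mpow)).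
rewrite integral_cst// (ge0_integralZl mu mK mpow pow0 k0).
apply: (@le_trans _ _ (C%:E * (t%:E * M%:E + (t `^ (1 - p))%:E * s%:E))).
  apply: lee_wpmul2l; first by rewrite lee_fin.
  apply: leeD; last exact: lee_wpmul2l.
  apply: lee_wpmul2l; first by rewrite lee_fin ltW.
  by rewrite -[leLHS](fineK Kfin) lee_fin /M lerDl.
rewrite -!EFinM lee_fin.
have -> : (C * (t * M + t `^ (1 - p) * s) = e * (C / (C + 1)))%R.
  by rewrite /s /t; field; rewrite !gt_eqF//= andbT.
rewrite -[leRHS]mulr1 ler_wpM2l ?ltW// ltr_pdivrMr// mul1r; lra.
Qed.


End power_integrals.

Lemma Rintegral_support d (T : measurableType d) (R : realType)
    (mu : {measure set T -> \bar R}) (D K : set T) (f : T -> R) :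
  K `<=` D -> (forall x, D x -> ~ K x -> f x = 0) ->
  \int[mu]_(x in D) f x = \int[mu]_(x in K) f x.
Proof.
move=> KD f0; rewrite Rintegral_mkcond [RHS]Rintegral_mkcond.
apply: eq_Rintegral => x _; rewrite !patchE.
have [/set_mem Kx|/negP Kx] := boolP (x \in K).
  by rewrite mem_set//; exact: KD.
case: ifPn => // /set_mem Dx; apply: f0 => // Kx'; apply: Kx; exact: mem_set.
Qed.

(** * The Euclidean norm *)

Section euclidean_norm.
Context {R : realType} {n : nat}.
Implicit Types (x y : 'rV[R]_n).

Lemma dot_ge0 x : 0 <= dot x x.
Proof. by apply: sumr_ge0 => i _; rewrite -expr2 sqr_ge0. Qed.

Lemma enorm_ge0 x : 0 <= enorm x.
Proof. exact: sqrtr_ge0. Qed.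

Lemma enormZ (a : R) x : enorm (a *: x) = `|a| * enorm x.
Proof.
rewrite /enorm -sqrtr_sqr -sqrtrM ?sqr_ge0//; congr Num.sqrt.
rewrite /dot mulr_sumr; apply: eq_bigr => i _; rewrite !mxE; ring.
Qed.

Lemma enorm0 : enorm (0 : 'rV[R]_n) = 0.
Proof. by rewrite -(scale0r 0) enormZ normr0 mul0r. Qed.

Lemma coord_le_enorm x i : `|x ord0 i| <= enorm x.
Proof. exact: le_trans (coord_le_norm x i) (norm_le_enorm x). Qed.

(** The factor 2 spares the Cauchy-Schwarz inequality: squares are compared coordinate by
    coordinate. *)
Lemma enormD_le x y : enorm (x + y) <= 2 * (enorm x + enorm y).
Proof.
have a0 := enorm_ge0 x; have b0 := enorm_ge0 y.
have ab : 0 <= 2 * (enorm x + enorm y) by rewrite mulr_ge0// addr_ge0.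
rewrite -(ler_sqr (enorm_ge0 _) ab).
have E z : enorm z ^+ 2 = dot z z := sqr_sqrtr (dot_ge0 z).
apply: (@le_trans _ _ (2 * (enorm x ^+ 2 + enorm y ^+ 2))).
  rewrite !E /dot -big_split/= mulr_sumr; apply: ler_sum => i _; rewrite !mxE.
  have := sqr_ge0 (x ord0 i - y ord0 i); nra.
have : 0 <= enorm x * enorm y by rewrite mulr_ge0.
by move: (sqr_ge0 (enorm x)) (sqr_ge0 (enorm y)); nra.
Qed.

Lemma enorm_continuous : continuous (enorm : 'rV[R]_n -> R).
Proof.
have cdot : continuous (fun x : 'rV[R]_n => dot x x).
  have csum (s : seq 'I_n) : continuous (fun x : 'rV[R]_n => \sum_(i <- s) x ord0 i * x ord0 i).
    elim: s => [|i s IH].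
      under eq_fun do rewrite big_nil; exact: cst_continuous.
    under eq_fun do rewrite big_cons.
    have ci : continuous (fun x : 'rV[R]_n => x ord0 i) by exact: coord_continuous.
    have cii : continuous (fun x : 'rV[R]_n => x ord0 i * x ord0 i).
      by move=> x; exact: (continuousM (ci x) (ci x)).
    by move=> x; exact: (continuousD (cii x) (IH x)).
  exact: csum.
move=> x; apply: (@continuous_comp _ _ _ (fun x => dot x x) Num.sqrt); first exact: cdot.
exact: sqrt_continuous.
Qed.

Lemma open_eball (r : R) : open [set x : 'rV[R]_n | enorm x < r].
Proof.
apply: (@open_comp _ _ enorm [set y | y < r]); last exact: open_lt.
by move=> x _; exact: enorm_continuous.
Qed.

Lemma bounded_eball (K : set 'rV[R]_n) : compact K ->
  exists r : R, K `<=` [set x | enorm x < r].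
Proof.
move=> cK; have [K0|/set0P K0] := eqVneq K set0; first by exists 0; rewrite K0.
have [c _ fc] := @EVT_max_rV R n enorm K K0 cK (continuous_subspaceT enorm_continuous).
by exists (enorm c + 1) => x Kx /=; rewrite ltr_pwDr// fc// inE.
Qed.

End euclidean_norm.

Section measurability.
Context {R : realType} {n : nat}.
Local Notation LT := (caratheodory_type (@lebesgue_outer R n)).
Implicit Types (U : set 'rV[R]_n).

(** U is a countable union of compact boxes, and f is integrable, hence measurable, on each of
    them. *)
Lemma loc_integrable_measurable U (f : 'rV[R]_n -> R) : open U -> loc_integrable U f ->
  measurable_fun (U : set LT) (f : LT -> R).
Proof.
move=> oU fU; have [K Kbox UE] := open_bigcup_box oU.
have cK k : compact (K k).
  case: (Kbox k) => [->|[a [b ->]]]; [exact: compact0|exact: box_compact].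
rewrite UE; apply/measurable_fun_bigcup => [k|k].
  exact: compact_measurable_leb.
apply/measurable_EFinP; apply: measurable_int (fU (K k) (cK k) _).
by rewrite UE; exact: bigcup_sup.
Qed.

Lemma measurable_enorm d (T : measurableType d) (D : set T) (G : T -> 'rV[R]_n) :
  (forall i, measurable_fun D (fun x => G x ord0 i)) ->
  measurable_fun D (fun x => enorm (G x)).
Proof.
move=> mG; rewrite (_ : (fun x => _) =
  Num.sqrt \o (fun x => \sum_(i < n) G x ord0 i * G x ord0 i))//.
apply: measurableT_comp.
  by apply: continuous_measurable_fun; exact: sqrt_continuous.
by apply: measurable_sum => i; exact: measurable_funM.
Qed.

Lemma measurable_continuous_comp d (T : measurableType d) (D : set T) (F : R -> R) (f : T -> R) :
  continuous F -> measurable_fun D f -> measurable_fun D (F \o f).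
Proof. by move=> cF mf; apply: measurableT_comp => //; exact: continuous_measurable_fun. Qed.

End measurability.

(** * Truncation of a function with a trace *)

Section truncation_regularity.
Context {R : realType} (d : R) (d0 : 0 < d).

Lemma trunc'_lipschitz : exists2 L, 0 <= L &
  forall s t, `|trunc' d s - trunc' d t| <= L * `|s - t|.
Proof.
have := trunc'_lip d0; set L := 2 * _ => lipL; exists L => //.
by rewrite /L !(mulr_ge0, addr_ge0, exprn_ge0, invr_ge0)// ltW.
Qed.

Lemma trunc_lip s t : `|trunc d s - trunc d t| <= `|s - t|.
Proof.
have [|h _] := @is_derive_mvt R R (trunc d) t 1 (s - t).
  by move=> r; have [] := trunc_is_derive d0 (t + r *: 1).
have -> : t + (s - t) *: (1 : R) = s by rewrite scaler1 addrC subrK.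
move=> ->.
have [_ ->] := trunc_is_derive d0 (t + h *: 1).
by rewrite normrM -[leRHS]mulr1 ler_wpM2l// trunc'_le1.
Qed.

Lemma lipschitz_continuous (f : R -> R) (L : R) :
  (forall s t, `|f s - f t| <= L * `|s - t|) -> continuous f.
Proof.
move=> fL s; apply/cvgrPdist_lt => e e0; apply/nbhs_ballP.
have L1 : 0 < `|L| + 1 by rewrite ltr_wpDl.
exists (e / (`|L| + 1)); first by rewrite /= divr_gt0.
move=> t; rewrite /ball /= ltr_pdivlMr// mulrC; apply: le_lt_trans.
apply: (le_trans (fL s t)); rewrite ler_wpM2r//.
by rewrite (le_trans (ler_norm _))// lerDl.
Qed.

Lemma trunc_continuous : continuous (trunc d).
Proof. by apply: (@lipschitz_continuous _ 1) => s t; rewrite mul1r trunc_lip. Qed.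

Lemma trunc'_continuous : continuous (trunc' d).
Proof. by have [L _ lipL] := trunc'_lipschitz; exact: lipschitz_continuous lipL. Qed.

End truncation_regularity.

Section truncated_triple.
Context {R : realType} {n : nat} (p : R) (p1 : 1 <= p) (d : R) (d0 : 0 < d).
Variables (Omega : set 'rV[R]_n) (u : 'rV[R]_n -> R) (G : 'rV[R]_n -> 'rV[R]_n).
Local Notation LT := (caratheodory_type (@lebesgue_outer R n)).
Local Notation U := (exterior Omega).
Local Notation E r := (U `&` [set x : 'rV[R]_n | enorm x < r]).
Local Notation T := (trunc d).
Local Notation T' := (trunc' d).

Lemma open_exterior : open U.
Proof. by apply: closed_openC; exact: closed_closure. Qed.

Let mU : measurable (U : set LT).
Proof. by apply: open_measurable_leb; exact: open_exterior. Qed.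

Let mE r : measurable (E r : set LT).
Proof.
apply: open_measurable_leb; apply: openI; first exact: open_exterior.
exact: open_eball.
Qed.

Hypothesis wG : weak_gradient U u G.
Hypothesis GLp : in_Lp (leb n) U p (enorm \o G).

Let mu_U : measurable_fun (U : set LT) (u : LT -> R).
Proof. by case: wG => + _ _; apply: loc_integrable_measurable; exact: open_exterior. Qed.

Let mG_U i : measurable_fun (U : set LT) ((fun x => G x ord0 i) : LT -> R).
Proof.
by case: wG => _ /(_ i) + _; apply: loc_integrable_measurable; exact: open_exterior.
Qed.

Let G_lty : (\int[leb n]_(x in U) (enorm (G x) `^ p)%:E < +oo)%E.
Proof.
have [_] := GLp; rewrite (eq_integral (fun x : LT => (enorm (G x) `^ p)%:E))// => x _.
by rewrite /= ger0_norm// enorm_ge0.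
Qed.

Let meG_U : measurable_fun (U : set LT) ((fun x => enorm (G x)) : LT -> R).
Proof. by have [] := GLp. Qed.

Let measurable_sub (A : set LT) (f : LT -> R) : A `<=` U -> measurable_fun (U : set LT) f ->
  measurable_fun A f.
Proof. by move=> AU; apply: measurable_funS. Qed.

Let EU r : E r `<=` U. Proof. by move=> x []. Qed.

Let mu_E r := measurable_sub (@EU r) mu_U.
Let mG_E r i := measurable_sub (@EU r) (mG_U i).

Let mT (A : set LT) (f : LT -> R) : measurable_fun A f -> measurable_fun A (T \o f).
Proof. by apply: measurable_continuous_comp; exact: trunc_continuous. Qed.

Let mT' (A : set LT) (f : LT -> R) : measurable_fun A f -> measurable_fun A (T' \o f).
Proof. by apply: measurable_continuous_comp; exact: trunc'_continuous. Qed.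

Section approximation.
Variable v : nat -> 'rV[R]_n -> R.
Hypothesis Cv : forall k, C1 (v k).
Hypothesis vu : forall r : R,
  (\int[leb n]_(x in E r) (`|v k x - u x| `^ p)%:E)%E @[k --> \oo] --> 0%E.
Hypothesis vG : forall r : R,
  (\int[leb n]_(x in E r) (enorm (grad (v k) x - G x) `^ p)%:E)%E @[k --> \oo] --> 0%E.

Lemma C1_trunc k : C1 (T \o v k).
Proof.
by have [] := C1_comp (Cv k) (trunc_is_derive d0) (trunc'_continuous d0).
Qed.

Lemma grad_trunc k x : grad (T \o v k) x = T' (v k x) *: grad (v k) x.
Proof.
have [_ dT] := C1_comp (Cv k) (trunc_is_derive d0) (trunc'_continuous d0).
by apply/rowP => i; rewrite !mxE dT.
Qed.

Let mv (A : set LT) k : measurable_fun A (v k : LT -> R).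
Proof. by apply: continuous_measurable_leb; exact: C1_continuous. Qed.

Let mdv (A : set LT) k i : measurable_fun A ((fun x => grad (v k) x ord0 i) : LT -> R).
Proof.
rewrite (_ : (fun x => _) = partial i (v k)); last by apply/funext => x; rewrite mxE.
by apply: continuous_measurable_leb; have [] := Cv k i.
Qed.

Let mvu r k : measurable_fun (E r : set LT) ((fun x => `|v k x - u x|) : LT -> R).
Proof.
apply: measurableT_comp; first exact: normr_measurable.
by apply: measurable_funB; [exact: mv|exact: mu_E].
Qed.

Let measurable_grad_trunc_sub r k : measurable_fun (E r : set LT)
  ((fun x => enorm (grad (T \o v k) x - T' (u x) *: G x)) : LT -> R).
Proof.
apply: measurable_enorm => i.
rewrite (_ : (fun x => _) =
  (fun x => T' (v k x) * grad (v k) x ord0 i - T' (u x) * G x ord0 i)).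
  apply: measurable_funB; apply: measurable_funM.
  + by apply: mT'; exact: mv.
  + exact: mdv.
  + by apply: mT'; exact: mu_E.
  + exact: mG_E.
by apply/funext => x; rewrite grad_trunc !mxE.
Qed.

Lemma trunc_cvg_fun (r : R) :
  (\int[leb n]_(x in E r) (`|(T \o v k) x - T (u x)| `^ p)%:E)%E @[k --> \oo] --> 0%E.
Proof.
apply: (@int_pow_cvg0_le _ LT R (leb n) p p1 (E r) 1
  (fun k x => `|(T \o v k) x - T (u x)|) (fun k x => `|v k x - u x|)).
- exact: mE.
- move=> k; apply: measurableT_comp; first exact: normr_measurable.
  by apply: measurable_funB; apply: mT; [exact: mv|exact: mu_E].
- exact: mvu.
- exact: ler01.
- by move=> k x _; rewrite normr_ge0 mul1r trunc_lip.
- by move=> k x _; exact: normr_ge0.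
- exact: vu.
Qed.

(** The difference splits into T'(v_k) (grad v_k - G), controlled by |T'| <= 1, and (T'(v_k) -
    T'(u)) G, a bounded factor that is Lipschitz in v_k - u times a fixed L^p function;
    [int_pow_cvg0M] is made for the latter. *)
Lemma trunc_cvg_grad (r : R) :
  (\int[leb n]_(x in E r)
     (enorm (grad (T \o v k) x - T' (u x) *: G x) `^ p)%:E)%E @[k --> \oo] --> 0%E.
Proof.
have [L L0 lipL] := trunc'_lipschitz d0.
have mdvG k i : measurable_fun (E r : set LT)
    ((fun x => (grad (v k) x - G x) ord0 i) : LT -> R).
  rewrite (_ : (fun x => _) = (fun x => grad (v k) x ord0 i - G x ord0 i)).
    by apply: measurable_funB; [exact: mdv|exact: mG_E].
  by apply/funext => x; rewrite !mxE.
have meG : measurable_fun (E r : set LT) (fun x => enorm (G x)).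
  by apply: measurable_enorm => i; exact: mG_E.
have medvG k : measurable_fun (E r : set LT) (fun x => enorm (grad (v k) x - G x)).
  by apply: measurable_enorm => i; exact: mdvG.
have mT'v k : measurable_fun (E r : set LT) ((fun x => T' (v k x)) : LT -> R).
  by apply: mT'; exact: mv.
have mT'u : measurable_fun (E r : set LT) ((fun x => T' (u x)) : LT -> R).
  by apply: mT'; exact: mu_E.
pose a k x := `|T' (v k x)| * enorm (grad (v k) x - G x).
pose b k x := `|T' (v k x) - T' (u x)| * enorm (G x).
have ma k : measurable_fun (E r : set LT) (a k : LT -> R).
  apply: measurable_funM; last exact: medvG.
  by apply: measurableT_comp; [exact: normr_measurable|exact: mT'v].
have mTT k : measurable_fun (E r : set LT) ((fun x => `|T' (v k x) - T' (u x)|) : LT -> R).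
  apply: measurableT_comp; first exact: normr_measurable.
  by apply: measurable_funB; [exact: mT'v|exact: mT'u].
have mb k : measurable_fun (E r : set LT) (b k : LT -> R).
  by apply: measurable_funM; [exact: mTT|exact: meG].
apply: (@int_pow_cvg0_le _ LT R (leb n) p p1 (E r) 2
  (fun k x => enorm (grad (T \o v k) x - T' (u x) *: G x)) (fun k x => a k x + b k x)).
- exact: mE.
- by move=> k; exact: measurable_grad_trunc_sub.
- by move=> k; exact: measurable_funD.
- by [].
- move=> k x _; rewrite enorm_ge0/= grad_trunc.
  rewrite (_ : _ - _ = T' (v k x) *: (grad (v k) x - G x) + (T' (v k x) - T' (u x)) *: G x).
    by apply: (le_trans (enormD_le _ _)); rewrite !enormZ.
  by apply/rowP => i; rewrite !mxE; ring.
- by move=> k x _; rewrite addr_ge0// mulr_ge0// enorm_ge0.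
have a0 k x : E r x -> 0 <= a k x by move=> _; rewrite mulr_ge0// enorm_ge0.
have b0 k x : E r x -> 0 <= b k x by move=> _; rewrite mulr_ge0// enorm_ge0.
apply: (@int_pow_cvg0D _ LT R (leb n) p p1 (E r) a b (mE r) ma mb a0 b0).
  apply: (@int_pow_cvg0_le _ LT R (leb n) p p1 (E r) 1 a
    (fun k x => enorm (grad (v k) x - G x)) (mE r) ma medvG ler01 _ _ (vG r)).
  - move=> k x Ex; rewrite a0//= mul1r -[leRHS]mul1r ler_wpM2r ?enorm_ge0//.
    exact: trunc'_le1.
  - by move=> k x _; exact: enorm_ge0.
apply: (@int_pow_cvg0M _ LT R (leb n) p p1 (E r) L (fun x => enorm (G x))
  (fun k x => `|T' (v k x) - T' (u x)|) (fun k x => `|v k x - u x|)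
  (mE r) meG mTT (@mvu r) L0 _ _ _ _ _ (vu r)).
- by move=> x _; exact: enorm_ge0.
- by move=> k x _; exact: normr_ge0.
- move=> k x _; rewrite normr_ge0/= (le_trans (ler_normB _ _))//.
  by rewrite (_ : 2 = 1 + 1)// lerD// trunc'_le1.
- by move=> k x _; exact: lipL.
- apply: le_lt_trans G_lty.
  apply: (@ge0_subset_integral _ LT R (leb n) (E r) U (mE r) mU
    (fun x => (enorm (G x) `^ p)%:E)).
  + by apply: measurable_pow; exact: meG_U.
  + by move=> x _; rewrite lee_fin powR_ge0.
  + exact: EU.
Qed.

(* The C^1 approximations provided by the trace play the role of mollifiers:
   integrate by parts for T \o v k and let k tend to infinity. *)
Lemma weak_gradient_trunc : weak_gradient U (T \o u) (fun x => T' (u x) *: G x).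
Proof.
have [iu iG weakG] := wG.
have TM x : `|T x| <= 2 * d^-1 by rewrite ger0_norm ?trunc_ge0// trunc_bounded.
have mK (K : set 'rV[R]_n) : compact K -> measurable (K : set LT) := @compact_measurable_leb R n K.
have iTu K (h : 'rV[R]_n -> R) C : compact K -> K `<=` U -> continuous h ->
    (forall x, `|h x| <= C) -> (leb n).-integrable K (EFin \o (fun x => T (u x) * h x)).
  move=> cK KU ch hC.
  apply: (@bounded_support_integrable _ LT R (leb n) K K (fun x => T (u x) * h x) (2 * d^-1 * C)).
  - exact: mK.
  - exact: mK.
  - exact: compact_leb_lty.
  - apply: measurable_funM; last exact: continuous_measurable_leb.
    by apply: mT; apply: measurable_sub mu_U.
  - by [].
  - by move=> x _; rewrite normrM ler_pM.
have iTG i K (h : 'rV[R]_n -> R) C : compact K -> K `<=` U -> continuous h ->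
    (forall x, `|h x| <= C) ->
    (leb n).-integrable K (EFin \o (fun x => (T' (u x) *: G x) ord0 i * h x)).
  move=> cK KU ch hC.
  apply: (@le_integrable _ LT R (leb n) K (mK K cK) _ (fun x => C%:E * (G x ord0 i)%:E)%E).
  - apply/measurable_EFinP; apply: measurable_funM; last exact: continuous_measurable_leb.
    rewrite (_ : (fun x => _) = (fun x => T' (u x) * G x ord0 i)); last first.
      by apply/funext => x; rewrite mxE.
    apply: measurable_funM; last by apply: measurable_sub (mG_U i).
    by apply: mT'; apply: measurable_sub mu_U.
  - move=> x Kx /=; rewrite lee_fin mxE !normrM mulrC.
    have C0 : 0 <= C by apply: le_trans (hC 0).
    rewrite (ger0_norm C0) ler_pM// ?mulr_ge0// -[leRHS]mul1r ler_wpM2r//.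
    exact: trunc'_le1.
  - by apply: (integrableZl (mK K cK)); exact: iG.
have c1 : continuous (cst 1 : 'rV[R]_n -> R) by exact: cst_continuous.
have n1 (x : 'rV[R]_n) : `|cst 1 x : R| <= 1 by rewrite normr1.
split.
- move=> K cK KU; have := iTu K (cst 1) 1 cK KU c1 n1.
  by rewrite (_ : (fun x => _) = T \o u)//; apply/funext => x /=; rewrite mulr1.
- move=> i K cK KU; have := iTG i K (cst 1) 1 cK KU c1 n1.
  rewrite (_ : (fun x => _) = (fun x => (T' (u x) *: G x) ord0 i))//.
  by apply/funext => x /=; rewrite mulr1.
move=> phi [sphi [K [cK KU phi0]]] i.
have Cphi : C1 phi := sphi [::].
have cphi := C1_continuous Cphi.
have [_ cdphi] := Cphi i.
have clK : closed K by apply: compact_closed => //; exact: norm_hausdorff.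
have dphi0 : forall x, ~ K x -> partial i phi x = 0 by exact: partial_eq0.
have [M M0 phiM] := compact_support_bounded cK cphi phi0.
have [M' M0' dphiM] := compact_support_bounded cK cdphi dphi0.
(* Convergence of v_k is known on bounded parts of the exterior only; a ball containing the support
   of phi makes it available there. *)
have [r Kr] := bounded_eball cK.
have KE : K `<=` E r by move=> x Kx; split; [exact: KU|exact: Kr].
have on_K (f : 'rV[R]_n -> R) : (forall x, ~ K x -> f x = 0) ->
    \int[leb n]_(x in U) f x = \int[leb n]_(x in K) f x.
  by move=> f0; apply: Rintegral_support => // x _; exact: f0.
rewrite on_K; last by move=> x Kx; rewrite dphi0// mulr0.
rewrite on_K; last by move=> x Kx; rewrite phi0// mulr0.
have restr (a : nat -> 'rV[R]_n -> R) : (forall k x, 0 <= a k x) ->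
    (forall k, measurable_fun (E r : set LT) (a k : LT -> R)) ->
    (\int[leb n]_(x in E r) (a k x `^ p)%:E)%E @[k --> \oo] --> 0%E ->
    (\int[leb n]_(x in K) (a k x `^ p)%:E)%E @[k --> \oo] --> 0%E.
  move=> a0 ma; apply: squeeze_cvge (cvg_cst 0%E); apply: nearW => k; apply/andP; split.
    by apply: integral_ge0 => x _; rewrite lee_fin powR_ge0.
  apply: (@ge0_subset_integral _ LT R (leb n) K (E r) (mK K cK) (mE r)
    (fun x => (a k x `^ p)%:E)).
  - by apply: measurable_pow; exact: ma.
  - by move=> x _; rewrite lee_fin powR_ge0.
  - exact: KE.
have lhs_cvg : \int[leb n]_(x in K) ((T \o v k) x * partial i phi x) @[k --> \oo] -->
    \int[leb n]_(x in K) (T (u x) * partial i phi x).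
  apply: (@cvg_Rintegral_mul _ LT R (leb n) p p1 K M' (fun x => T (u x))
    (fun k => T \o v k) (partial i phi) (mK K cK) (compact_leb_lty cK) M0').
  - by apply: mT; apply: measurable_sub mu_U.
  - by move=> k; apply: mT; exact: mv.
  - by move=> x _; exact: dphiM.
  - exact: (iTu K (partial i phi) M').
  - move=> k; apply: (@compact_support_integrable R n K K
      (fun x => (T \o v k) x * partial i phi x) (mK K cK) cK).
      move=> x; have cT := C1_continuous (C1_trunc k).
      exact: (continuousM (cT x) (cdphi x)).
    by move=> x Kx; rewrite dphi0// mulr0.
  - apply: (restr (fun k x => `|(T \o v k) x - T (u x)|)).
    + by move=> k x; exact: normr_ge0.
    + move=> k; apply: measurableT_comp; first exact: normr_measurable.
      by apply: measurable_funB; apply: mT; [exact: mv|exact: mu_E].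
    + exact: trunc_cvg_fun.
have rhs_cvg : \int[leb n]_(x in K) (partial i (T \o v k) x * phi x) @[k --> \oo] -->
    \int[leb n]_(x in K) ((T' (u x) *: G x) ord0 i * phi x).
  have mdT (A : set LT) k : measurable_fun A (partial i (T \o v k) : LT -> R).
    by apply: continuous_measurable_leb; have [] := C1_trunc k i.
  have mTG (A : set LT) : A `<=` U ->
      measurable_fun A ((fun x => (T' (u x) *: G x) ord0 i) : LT -> R).
    move=> AU; rewrite (_ : (fun x => _) = (fun x => T' (u x) * G x ord0 i)); last first.
      by apply/funext => x; rewrite mxE.
    apply: measurable_funM; last by apply: measurable_sub (mG_U i).
    by apply: mT'; apply: measurable_sub mu_U.
  apply: (@cvg_Rintegral_mul _ LT R (leb n) p p1 K M
    (fun x => (T' (u x) *: G x) ord0 i)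
    (fun k => partial i (T \o v k)) phi (mK K cK) (compact_leb_lty cK) M0).
  - exact: mTG.
  - by move=> k; exact: mdT.
  - by move=> x _; exact: phiM.
  - exact: (iTG i K phi M).
  - move=> k; apply: (@compact_support_integrable R n K K
      (fun x => partial i (T \o v k) x * phi x) (mK K cK) cK).
      move=> x; have [_ cT] := C1_trunc k i.
      exact: (continuousM (cT x) (cphi x)).
    by move=> x Kx; rewrite phi0// mulr0.
  - apply: (restr (fun k x => `|partial i (T \o v k) x - (T' (u x) *: G x) ord0 i|)).
    + by move=> k x; exact: normr_ge0.
    + move=> k; apply: measurableT_comp; first exact: normr_measurable.
      by apply: measurable_funB; [exact: mdT|apply: mTG; exact: EU].
    + apply: (@int_pow_cvg0_le _ LT R (leb n) p p1 (E r) 1 _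
        (fun k x => enorm (grad (T \o v k) x - T' (u x) *: G x)) (mE r) _ _ ler01 _ _
        (trunc_cvg_grad r)).
      * move=> k; apply: measurableT_comp; first exact: normr_measurable.
        by apply: measurable_funB; [exact: mdT|apply: mTG; exact: EU].
      * exact: measurable_grad_trunc_sub.
      * move=> k x _; rewrite normr_ge0 mul1r.
        have := coord_le_enorm (grad (T \o v k) x - T' (u x) *: G x) i.
        by rewrite !mxE.
      * by move=> k x _; exact: enorm_ge0.
(* For each k the C^1 formula equates the two sequences up to sign, so their limits agree. *)
apply: (cvg_unique _ lhs_cvg); first exact: norm_hausdorff.
have : - (\int[leb n]_(x in K) (partial i (T \o v k) x * phi x)) @[k --> \oo] -->
    - \int[leb n]_(x in K) ((T' (u x) *: G x) ord0 i * phi x) by exact: cvgN.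
apply: cvg_trans; apply: near_eq_cvg; apply: nearW => k.
apply/esym; exact: (integration_by_parts_C1 i (mK K cK) (C1_trunc k) Cphi cK (@subset_refl _ K) phi0).
Qed.


End approximation.
End truncated_triple.

Lemma bounded_support_int_pow d (T : measurableType d) (R : realType)
    (mu : {measure set T -> \bar R}) (p : R) (D K : set T) (a : T -> R) (M : R) :
  1 <= p -> measurable D -> measurable K -> (mu K < +oo)%E -> measurable_fun D a ->
  (forall x, D x -> ~ K x -> a x = 0) -> (forall x, D x -> 0 <= a x <= M) ->
  (\int[mu]_(x in D) (a x `^ p)%:E < +oo)%E.
Proof.
move=> p1 mD mK Koo ma a0 aM; have p0 : 0 < p by exact: lt_le_trans p1.
have mpow := measurable_pow p ma.
have := @bounded_support_integrable _ T R mu D K (fun x => a x `^ p) (M `^ p) mD mK Koo.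
case/(_ _ _ _)/integrableP.
- exact/measurable_EFinP.
- by move=> x Dx Kx; rewrite a0// powR0// gt_eqF.
- move=> x Dx; have /andP[ax axM] := aM x Dx; rewrite ger0_norm ?powR_ge0//.
  by rewrite ge0_ler_powR ?nnegrE ?(ltW p0)// (le_trans ax).
move=> _; under eq_integral do rewrite /= ger0_norm ?powR_ge0//.
exact.
Qed.

(** * Integrability and trace of the truncated function *)

Section truncated_sobolev.
Context {R : realType} {n : nat} (p : R) (p1 : 1 <= p) (d : R) (d0 : 0 < d).
Variables (Omega : set 'rV[R]_n) (u : 'rV[R]_n -> R) (G : 'rV[R]_n -> 'rV[R]_n).
Variable g : 'rV[R]_n -> R.
Local Notation LT := (caratheodory_type (@lebesgue_outer R n)).
Local Notation ST := (caratheodory_type (@hausdorff_outer R n n.-1)).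
Local Notation U := (exterior Omega).
Local Notation T := (trunc d).
Local Notation T' := (trunc' d).

Lemma measurable_exterior : measurable (U : set LT).
Proof. by apply: open_measurable_leb; exact: open_exterior. Qed.

Lemma measurable_boundary : measurable (boundary Omega : set ST).
Proof.
apply: closed_measurable_hausdorff; rewrite /boundary setDE.
apply: closedI; first exact: closed_closure.
by apply: open_closedC; exact: open_interior.
Qed.

Lemma continuous_measurable_surface (A : set ST) (f : 'rV[R]_n -> R) :
  continuous f -> measurable_fun A (f : ST -> R).
Proof. by apply: continuous_measurable_cara => B; exact: open_measurable_hausdorff. Qed.

Hypothesis fe : finite_energy p U u G.

Let wG : weak_gradient U u G. Proof. by case: fe. Qed.
Let GLp : in_Lp (leb n) U p (enorm \o G). Proof. by case: fe. Qed.

Let mu_U : measurable_fun (U : set LT) (u : LT -> R).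
Proof. by case: wG => + _ _; apply: loc_integrable_measurable; exact: open_exterior. Qed.

Lemma trunc_energy_le :
  (\int[leb n]_(x in U) (enorm (T' (u x) *: G x) `^ p)%:E <=
   \int[leb n]_(x in U) (enorm (G x) `^ p)%:E)%E.
Proof.
have mG : measurable_fun (U : set LT) ((fun x => enorm (G x)) : LT -> R) by case: GLp.
apply: (@le_int_pow _ LT R (leb n) p p1 U _ (fun x => enorm (G x)) measurable_exterior _ mG).
  rewrite (_ : (fun x => _) = (fun x => `|T' (u x)| * enorm (G x))).
    apply: measurable_funM; last exact: mG.
    apply: measurableT_comp; first exact: normr_measurable.
    by apply: measurable_continuous_comp; [exact: trunc'_continuous|exact: mu_U].
  by apply/funext => x; rewrite enormZ.
move=> x _; rewrite enorm_ge0/= enormZ -[leRHS]mul1r ler_wpM2r ?enorm_ge0//.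
exact: trunc'_le1.
Qed.

Lemma sobolev_trunc : trace p Omega u G g ->
  sobolev p U (T \o u) (fun x => T' (u x) *: G x).
Proof.
move=> [_ [v [Cv vu vG _]]].
have mTu : measurable_fun (U : set LT) ((T \o u) : LT -> R).
  by apply: measurable_continuous_comp; [exact: trunc_continuous|exact: mu_U].
have p0 : 0 < p by exact: lt_le_trans p1.
split.
- exact: (weak_gradient_trunc p1 d0 wG GLp Cv vu vG).
- split; first exact: mTu.
  pose A : set 'rV[R]_n := U `&` [set x | d <= `|u x|].
  have mA : measurable (A : set LT).
    have mnu : measurable_fun (U : set LT) ((fun x => `|u x|) : LT -> R).
      by apply: measurableT_comp; [exact: normr_measurable|exact: mu_U].
    have := mnu measurable_exterior `[d, +oo[%classic (measurable_itv _).
    rewrite (_ : _ `&` _ = A)//.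
    by apply/seteqP; split => x [Ux]; rewrite /= in_itv/= andbT.
  have Aoo : (leb n A < +oo)%E by case: fe => _ _; exact.
  apply: (@bounded_support_int_pow _ LT R (leb n) p U A (fun x => `|(T \o u) x|)
    (2 * d^-1) p1 measurable_exterior mA Aoo).
  + by apply: measurableT_comp; [exact: normr_measurable|exact: mTu].
  + move=> x Ux /not_andP[//|/negP]; rewrite -ltNge => /ltW ud /=.
    by rewrite trunc_eq0// normr0.
  + by move=> x _; rewrite normr_ge0/= ger0_norm ?trunc_ge0// trunc_bounded.
- have mG : measurable_fun (U : set LT) ((fun x => enorm (G x)) : LT -> R) by case: GLp.
  split.
    rewrite (_ : _ \o _ = (fun x => `|T' (u x)| * enorm (G x))).
      apply: measurable_funM; last exact: mG.
      apply: measurableT_comp; first exact: normr_measurable.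
      by apply: measurable_continuous_comp; [exact: trunc'_continuous|exact: mu_U].
    by apply/funext => x /=; rewrite enormZ.
  have [_] := GLp; apply: le_lt_trans.
  have E (H : 'rV[R]_n -> 'rV[R]_n) : (\int[leb n]_(x in U) (`|(enorm \o H) x| `^ p)%:E =
      \int[leb n]_(x in U) (enorm (H x) `^ p)%:E)%E.
    by apply: eq_integral => x _; rewrite /= ger0_norm// enorm_ge0.
  by rewrite !E; exact: trunc_energy_le.
Qed.

(** The functions T(v_k) serve as approximations; on the boundary they converge because T is
    1-Lipschitz, and |T(s)| <= |s| keeps T(g) in L^p. *)
Lemma trace_trunc : trace p Omega u G g ->
  trace p Omega (T \o u) (fun x => T' (u x) *: G x) (T \o g).
Proof.
move=> [[mg glty] [v [Cv vu vG vg]]].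
have mTg : measurable_fun (boundary Omega : set ST) ((T \o g) : ST -> R).
  by apply: measurable_continuous_comp; [exact: trunc_continuous|exact: mg].
split.
  split; first exact: mTg.
  apply: le_lt_trans glty.
  apply: (@le_int_pow _ ST R (hausdorff n n.-1) p p1 (boundary Omega)
    (fun x => `|(T \o g) x|) (fun x => `|g x|) measurable_boundary).
  - by apply: measurableT_comp; [exact: normr_measurable|exact: mTg].
  - by apply: measurableT_comp; [exact: normr_measurable|exact: mg].
  - by move=> x _; rewrite normr_ge0/= ger0_norm ?trunc_ge0// trunc_le.
exists (fun k => T \o v k); split.
- exact: (C1_trunc d0 Cv).
- exact: (trunc_cvg_fun p1 d0 wG Cv vu).
- exact: (trunc_cvg_grad p1 d0 wG GLp Cv vu vG).
- have mv k : measurable_fun (boundary Omega : set ST) (v k : ST -> R).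
    by apply: continuous_measurable_surface; exact: C1_continuous.
  apply: (@int_pow_cvg0_le _ ST R (hausdorff n n.-1) p p1 (boundary Omega) 1
    (fun k x => `|(T \o v k) x - (T \o g) x|) (fun k x => `|v k x - g x|)
    measurable_boundary _ _ ler01 _ _ vg).
  + move=> k; apply: measurableT_comp; first exact: normr_measurable.
    apply: measurable_funB; last exact: mTg.
    by apply: measurable_continuous_comp; [exact: trunc_continuous|exact: mv].
  + move=> k; apply: measurableT_comp; first exact: normr_measurable.
    by apply: measurable_funB; [exact: mv|exact: mg].
  + by move=> k x _; rewrite normr_ge0/= mul1r trunc_lip.
  + by move=> k x _; exact: normr_ge0.
Qed.

End truncated_sobolev.

(** * Functions supported in the exterior domain *)

Lemma ae_eq_int_pow d (T : measurableType d) (R : realType)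
    (mu : {measure set T -> \bar R}) (p : R) (D : set T) (a b : T -> R) :
  measurable D -> measurable_fun D a -> measurable_fun D b ->
  {ae mu, forall x, D x -> a x = b x} ->
  (\int[mu]_(x in D) (a x `^ p)%:E = \int[mu]_(x in D) (b x `^ p)%:E)%E.
Proof.
move=> mD ma mb ab; apply: ae_eq_integral => //; [exact: measurable_pow..|].
by apply: filterS ab => x abx Dx; rewrite abx.
Qed.

Lemma int_pow_eq0 d (T : measurableType d) (R : realType)
    (mu : {measure set T -> \bar R}) (p : R) (D : set T) (a : T -> R) :
  1 <= p -> measurable D -> measurable_fun D a ->
  (\int[mu]_(x in D) (`|a x| `^ p)%:E = 0)%E <-> {ae mu, forall x, D x -> a x = 0}.
Proof.
move=> p1 mD ma; have p0 : p != 0 by rewrite gt_eqF// (lt_le_trans _ p1).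
have mn : measurable_fun D (fun x => `|a x|).
  by apply: measurableT_comp.
have E : (\int[mu]_(x in D) (`|a x| `^ p)%:E = \int[mu]_(x in D) `|(`|a x| `^ p)%:E|)%E.
  by apply: eq_integral => x _; rewrite gee0_abs// lee_fin powR_ge0.
rewrite E; split=> [/(ae_eq_integral_abs mu mD (measurable_pow p mn))|a0].
  apply: filterS => x ax0 Dx; have [] := ax0 Dx => /eqP.
  by rewrite powR_eq0 normr_eq0 => /andP[/eqP->].
apply/(ae_eq_integral_abs mu mD (measurable_pow p mn)).
by apply: filterS a0 => x ax Dx; rewrite ax// normr0 powR0.
Qed.

Section smooth_bump.
Context {R : realType} {n : nat}.
Implicit Types (x a : 'rV[R]_n).

Let q a (r : R) x : R := r ^+ 2 - dot (x - a) (x - a).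

Let q_C1 a r : C1 (q a r).
Proof.
suff [] : C1 (q a r) /\ (forall i, partial i (q a r) = (fun x => - 2 * (x ord0 i - a ord0 i))).
  by [].
apply: C1P => [i x|i x].
  have xE : x = x + 0 *: (delta_mx ord0 i : 'rV[R]_n) by rewrite scale0r addr0.
  rewrite {1}xE; apply/is_derive_line.
  rewrite (_ : (fun h : R => _) = (fun h : R => q a r x - 2 * (x ord0 i - a ord0 i) * h - h ^+ 2)).
    have -> : (fun h : R => q a r x - 2 * (x ord0 i - a ord0 i) * h - h ^+ 2) =
        (fun=> q a r x) - (2 * (x ord0 i - a ord0 i)) *: id - id ^+ 2.
      by apply/funext => h.
    apply: is_derive_eq; rewrite /GRing.scale/= expr1; ring.
  apply/funext => h; rewrite /q /dot (bigD1 i)//= [in RHS](bigD1 i)//= !mxE !eqxx/=.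
  under eq_bigr => j ji do rewrite !mxE (negbTE ji) andbF mulr0 addr0.
  under [in RHS]eq_bigr => j ji do rewrite !mxE.
  ring.
have ci : continuous (fun x : 'rV[R]_n => x ord0 i) by exact: coord_continuous.
have cc (c : R) : continuous (cst c : 'rV[R]_n -> R) by exact: cst_continuous.
have cd : continuous (fun x : 'rV[R]_n => x ord0 i - a ord0 i).
  by move=> y; exact: (continuousB (ci y) (cc _ y)).
exact: (continuousM (cc _ x) (cd x)).
Qed.

(** Squaring the positive part makes it C^1. This regularity suffices: the bump enters as an
    admissible function of the Rayleigh quotient, not as a test function. *)
Let sqpos (t : R) := Num.max t 0 ^+ 2.

Let is_derive_sqpos (t : R) : is_derive t 1 sqpos (2 * Num.max t 0).
Proof.
apply: (@is_derive_posfun R (fun t => t ^+ 2) (fun t => 2 * t)).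
- move=> s _; have -> : (fun y : R => y ^+ 2) = id ^+ 2 by apply/funext.
  by apply: is_derive_eq; rewrite /= expr1 /GRing.scale/= mulr1 mulr_natl.
- by rewrite expr0n.
- by rewrite mulr0.
Qed.

Let sqpos'_continuous : continuous (fun t : R => 2 * Num.max t 0).
Proof.
apply: (@lipschitz_continuous R _ 2) => s t; rewrite -mulrBr normrM ger0_norm// ler_wpM2l//.
have := ler_norm (s - t); have := ler_norm (t - s); rewrite distrC ler_norml.
by case: (leP s 0) => s0; case: (leP t 0) => t0 *; apply/andP; split; lra.
Qed.

(** The function is the squared positive part of r^2 - |x - a|^2. A null set containing its nonzero
    points in U would contain a small cube around a, whose measure is positive by [leb_box_ge]. *)
Lemma exists_bump (U : set 'rV[R]_n) : open U -> U !=set0 ->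
  exists phi K, [/\ C1 phi, compact K, K `<=` U, forall x, ~ K x -> phi x = 0 &
    ~ {ae leb n, forall x, U x -> phi x = 0}].
Proof.
move=> oU [a Ua].
have /nbhs_ballP[e /= e0 eU] : nbhs a U by exact: open_nbhs_nbhs.
(* Halving puts the closed Euclidean ball of radius r inside the open ball of radius e in the
   maximum norm. *)
pose r := e / 2; have r0 : 0 < r by rewrite divr_gt0.
pose K : set 'rV[R]_n := [set x | enorm (x - a) <= r].
have KB x : K x -> `|x - a| <= r by exact: le_trans (norm_le_enorm _).
have cK : compact K.
  apply: bounded_closed_compact.
    exists (`|a| + r); split; first by rewrite num_real.
    move=> M aM x /KB xa; apply: (le_trans _ (ltW aM)).
    by rewrite -[x](subrK a) (le_trans (ler_normD _ _))// addrC lerD2l.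
  have cshift : continuous (fun x : 'rV[R]_n => enorm (x - a)).
    move=> x; apply: (@continuous_comp _ _ _ (fun x : 'rV[R]_n => x - a) enorm);
      last exact: enorm_continuous.
    exact: (@continuousD _ _ _ (id : 'rV[R]_n -> 'rV[R]_n) (cst (- a)) x
      (fun _ h => h) (@cst_continuous _ _ _ x)).
  by apply: (@closed_comp _ _ (fun x : 'rV[R]_n => enorm (x - a)) [set y | y <= r]) => //;
    exact: closed_le.
have qE x : q a r x = r ^+ 2 - enorm (x - a) ^+ 2.
  by rewrite /q [enorm _ ^+ 2](sqr_sqrtr (dot_ge0 _)).
have KU : K `<=` U.
  move=> x /KB xa; apply: eU; rewrite mx_norm_ball /ball_ /= distrC.
  by rewrite (le_lt_trans xa)// /r ltr_pdivrMr// ltr_pMr// ltr1n.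
exists (sqpos \o q a r), K; split => //.
- by have [] := C1_comp (q_C1 a r) is_derive_sqpos sqpos'_continuous.
- move=> x /negP; rewrite -ltNge => xa /=.
  have q0 : q a r x <= 0.
    by rewrite qE subr_le0 ler_sqr ?nnegrE ?enorm_ge0 ?(ltW r0)// ltW.
  by rewrite /sqpos max_r// expr0n.
move=> -[N [mN N0 phiN]].
(* The cube of half-side t lies strictly inside the Euclidean ball, since n t^2 < (n + 1)^2 t^2 =
   r^2. *)
pose t := r / n.+1%:R; have t0 : 0 < t by rewrite divr_gt0.
pose lo : 'rV[R]_n := a - const_mx t; pose hi : 'rV[R]_n := a + const_mx t.
have lohi i : lo ord0 i <= hi ord0 i by rewrite !mxE; move: t0; lra.
have : (leb n (box lo hi) <= leb n N)%E.
  apply: (le_outer_measure (lebesgue_outer n)) => x xbox; apply: phiN => /= phix.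
  have xt i : `|x ord0 i - a ord0 i| <= t.
    have := xbox i; rewrite !mxE => /andP[h1 h2]; rewrite ler_norml.
    by apply/andP; split; lra.
  have dlt : dot (x - a) (x - a) < r ^+ 2.
    apply: (@le_lt_trans _ _ (\sum_(i < n) t ^+ 2)).
      apply: ler_sum => i _; rewrite !mxE -expr2 -[leLHS]real_normK ?num_real//.
      by rewrite ler_sqr ?nnegrE ?(ltW t0)//; exact: xt.
    rewrite sumr_const card_ord -mulr_natr (_ : r = t * n.+1%:R); last first.
      by rewrite /t divfK.
    rewrite [ltRHS]exprMn ltr_pM2l ?exprn_gt0// -natrX ltr_nat.
    by rewrite (leq_trans (ltnSn n))// leq_pmulr.
  have q0 : 0 < q a r x by rewrite /q subr_gt0.
  have Kx : K x.
    rewrite /K /= -(ler_sqr (enorm_ge0 _) (ltW r0)).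
    by move: q0; rewrite qE subr_gt0 => /ltW.
  have /eqP := phix (KU x Kx); rewrite /sqpos max_l; last exact: ltW.
  by rewrite gt_eqF ?exprn_gt0.
move=> boxN; have N0' : leb n N = 0%E by exact: N0.
rewrite N0' in boxN; suff : (0 < leb n (box lo hi))%E by rewrite ltNge boxN.
apply: lt_le_trans (leb_box_ge lohi); rewrite lte_fin; apply: prodr_gt0 => i _.
by rewrite !mxE; move: t0; lra.
Qed.
End smooth_bump.

Lemma ae_mono d (T : measurableType d) (R : realType)
    (mu : {measure set T -> \bar R}) (P Q : T -> Prop) :
  (forall x, P x -> Q x) -> {ae mu, forall x, P x} -> {ae mu, forall x, Q x}.
Proof. by move=> PQ; apply: filterS. Qed.

(** * Compactly supported functions and traces of the zero function *)

Section compactly_supported.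
Context {R : realType} {n : nat} (p : R) (p1 : 1 <= p) (Omega : set 'rV[R]_n).
Local Notation LT := (caratheodory_type (@lebesgue_outer R n)).
Local Notation ST := (caratheodory_type (@hausdorff_outer R n n.-1)).
Local Notation U := (exterior Omega).
Local Notation E r := (U `&` [set x : 'rV[R]_n | enorm x < r]).
Variables (phi : 'rV[R]_n -> R) (K : set 'rV[R]_n).
Hypotheses (Cphi : C1 phi) (cK : compact K) (KU : K `<=` U).
Hypothesis phi0 : forall x, ~ K x -> phi x = 0.

Let mE r : measurable (E r : set LT).
Proof.
apply: open_measurable_leb; apply: openI; first exact: open_exterior.
exact: open_eball.
Qed.

Let cphi : continuous phi. Proof. exact: C1_continuous. Qed.

Let cdphi i : continuous (partial i phi). Proof. by have [] := Cphi i. Qed.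

Let clK : closed K.
Proof. by apply: compact_closed => //; exact: norm_hausdorff. Qed.

Let mgphi (A : set LT) i : measurable_fun A ((fun x => grad phi x ord0 i) : LT -> R).
Proof.
rewrite (_ : (fun x => _) = partial i phi); last by apply/funext => x; rewrite mxE.
by apply: continuous_measurable_leb; exact: cdphi.
Qed.

Let dphi0 i x : ~ K x -> partial i phi x = 0.
Proof. exact: (@partial_eq0 R n phi i K clK phi0). Qed.

Lemma grad_bounded : exists M : R, forall x, enorm (grad phi x) <= M.
Proof.
have M i : exists M, forall x, partial i phi x ^+ 2 <= M.
  have [M M0 dM] := compact_support_bounded cK (@cdphi i) (@dphi0 i).
  exists (M ^+ 2) => x; rewrite -[leLHS]real_normK ?num_real// ler_sqr ?nnegrE//.
pose m i := projT1 (cid (M i)).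
have mP i x : partial i phi x ^+ 2 <= m i := projT2 (cid (M i)) x.
exists (Num.sqrt (\sum_(i < n) m i)) => x; apply: ler_wsqrtr.
by apply: ler_sum => i _; rewrite !mxE -expr2.
Qed.

Lemma sobolev_C1_compact : sobolev p U phi (grad phi).
Proof.
have mU := @measurable_exterior R n Omega.
have mK : measurable (K : set LT) := compact_measurable_leb cK.
have Koo := compact_leb_lty cK.
split.
- split.
  + move=> K' cK' _; apply: (@compact_support_integrable R n K' K phi _ cK cphi phi0).
    exact: compact_measurable_leb.
  + move=> i K' cK' _; rewrite (_ : (fun x => _) = partial i phi); last first.
      by apply/funext => x; rewrite mxE.
    apply: (@compact_support_integrable R n K' K (partial i phi) _ cK (@cdphi i) (@dphi0 i)).
    exact: compact_measurable_leb.
  + move=> psi [spsi [K' [cK' K'U psi0]]] i.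
    have Cpsi : C1 psi := spsi [::].
    rewrite (integration_by_parts_C1 i mU Cphi Cpsi cK' K'U psi0).
    by congr (- _); apply: eq_Rintegral => x _; rewrite mxE.
- split; first by apply: continuous_measurable_leb.
  have [M M0 phiM] := compact_support_bounded cK cphi phi0.
  apply: (@bounded_support_int_pow _ LT R (leb n) p U K (fun x => `|phi x|) M p1 mU mK Koo).
  + apply: measurableT_comp; first exact: normr_measurable.
    exact: continuous_measurable_leb.
  + by move=> x _ /phi0 ->; rewrite normr0.
  + by move=> x _; rewrite normr_ge0 phiM.
- have meg : measurable_fun (U : set LT) ((fun x => enorm (grad phi x)) : LT -> R).
    by apply: measurable_enorm => i; exact: mgphi.
  split; first exact: meg.
  have [M gM] := grad_bounded.
  apply: (@bounded_support_int_pow _ LT R (leb n) p U K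
    (fun x => `|(enorm \o grad phi) x|) M p1 mU mK Koo).
  + by apply: measurableT_comp; [exact: normr_measurable|exact: meg].
  + move=> x _ Kx; rewrite /= (_ : grad phi x = 0) ?enorm0 ?normr0//.
    by apply/rowP => i; rewrite !mxE dphi0.
  + by move=> x _; rewrite normr_ge0/= ger0_norm ?enorm_ge0.
Qed.

(* A trace g of the zero function may be attached to any function supported
   away from the boundary; this replaces the uniqueness of traces. *)
Lemma trace_add_null (w : 'rV[R]_n -> R) (H : 'rV[R]_n -> 'rV[R]_n) g s :
  0 <= s -> weak_gradient U w H ->
  {ae leb n, forall x, U x -> w x = 0} -> {ae leb n, forall x, U x -> H x = 0} ->
  trace p Omega w H g -> trace p Omega phi (grad phi) (fun x => s * g x).
Proof.
move=> s0 [iw iH _] w0 H0 [[mg glty] [v [Cv vw vH vg]]].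
have mB := @measurable_boundary R n Omega.
have mw r : measurable_fun (E r : set LT) (w : LT -> R).
  have := loc_integrable_measurable (@open_exterior R n Omega) iw.
  by apply: measurable_funS; [exact: measurable_exterior|move=> x []].
have mH r i : measurable_fun (E r : set LT) ((fun x => H x ord0 i) : LT -> R).
  have := loc_integrable_measurable (@open_exterior R n Omega) (iH i).
  by apply: measurable_funS; [exact: measurable_exterior|move=> x []].
have mv (A : set LT) k : measurable_fun A (v k : LT -> R).
  by apply: continuous_measurable_leb; exact: C1_continuous.
have mdv (A : set LT) k i : measurable_fun A ((fun x => grad (v k) x ord0 i) : LT -> R).
  rewrite (_ : (fun x => _) = partial i (v k)); last by apply/funext => x; rewrite mxE.
  by apply: continuous_measurable_leb; have [] := Cv k i.
have mvS k : measurable_fun (boundary Omega : set ST) (v k : ST -> R).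
  by apply: continuous_measurable_surface; exact: C1_continuous.
have mgS : measurable_fun (boundary Omega : set ST) ((fun x => `|g x|) : ST -> R).
  by apply: measurableT_comp; [exact: normr_measurable|exact: mg].
(* On bounded parts of the exterior v_k and its gradient tend to 0, as w and H are null, so v'
   approximates phi; on the boundary phi vanishes and v' approximates s g. *)
pose v' k := phi \+ (s \*o v k).
have v'P k : C1 (v' k) /\ (forall x, grad (v' k) x = grad phi x + s *: grad (v k) x).
  have [Csv dsv] := C1Z s (Cv k); have [Cv' dv'] := C1D Cphi Csv.
  by split => // x; apply/rowP => i; rewrite !mxE dv' dsv.
split.
  split.
    by apply: measurable_funM; [exact: measurable_cst|exact: mg].
  have sg := @int_powZ _ ST R (hausdorff n n.-1) p (boundary Omega) s (fun x => `|g x|)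
    mB mgS s0 (fun x _ => normr_ge0 (g x)).
  have -> : (\int[surface]_(x in boundary Omega) (`|s * g x| `^ p)%:E =
      \int[surface]_(x in boundary Omega) ((s * `|g x|) `^ p)%:E)%E.
    by apply: eq_integral => x _; rewrite normrM (ger0_norm s0).
  rewrite sg; apply: lte_mul_pinfty; [by rewrite lee_fin powR_ge0|by []|exact: glty].
have v_cvg r : (\int[leb n]_(x in E r) (`|v k x| `^ p)%:E)%E @[k --> \oo] --> 0%E.
  have Ek : (fun k => \int[leb n]_(x in E r) (`|v k x - w x| `^ p)%:E)%E =
      (fun k => \int[leb n]_(x in E r) (`|v k x| `^ p)%:E)%E.
    apply/funext => k; apply: (@ae_eq_int_pow _ LT R (leb n) p (E r) _ _ (mE r)).
    - apply: measurableT_comp; first exact: normr_measurable.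
      by apply: measurable_funB; [exact: mv|exact: mw].
    - by apply: measurableT_comp; [exact: normr_measurable|exact: mv].
    - apply: (@ae_mono _ LT R (leb n) (fun x => U x -> w x = 0) _ _ w0) => x wx [Ux _].
      by rewrite wx// subr0.
  by rewrite -Ek; exact: vw.
have dv_cvg r : (\int[leb n]_(x in E r) (enorm (grad (v k) x) `^ p)%:E)%E @[k --> \oo] --> 0%E.
  have Ek : (fun k => \int[leb n]_(x in E r) (enorm (grad (v k) x - H x) `^ p)%:E)%E =
      (fun k => \int[leb n]_(x in E r) (enorm (grad (v k) x) `^ p)%:E)%E.
    apply/funext => k; apply: (@ae_eq_int_pow _ LT R (leb n) p (E r) _ _ (mE r)).
    - apply: measurable_enorm => i.
      rewrite (_ : (fun x => _) = (fun x => grad (v k) x ord0 i - H x ord0 i)).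
        by apply: measurable_funB; [exact: mdv|exact: mH].
      by apply/funext => x; rewrite !mxE.
    - by apply: measurable_enorm => i; exact: mdv.
    - apply: (@ae_mono _ LT R (leb n) (fun x => U x -> H x = 0) _ _ H0) => x Hx [Ux _].
      by rewrite Hx// subr0.
  by rewrite -Ek; exact: vH.
exists v'; split.
- by move=> k; have [] := v'P k.
- move=> r.
  apply: (@int_pow_cvg0_le _ LT R (leb n) p p1 (E r) s
    (fun k x => `|v' k x - phi x|) (fun k x => `|v k x|) (mE r) _ _ s0 _ _ (v_cvg r)).
  + move=> k; apply: measurableT_comp; first exact: normr_measurable.
    apply: measurable_funB; apply: continuous_measurable_leb => //.
    by apply: C1_continuous; have [] := v'P k.
  + by move=> k; apply: measurableT_comp; [exact: normr_measurable|exact: mv].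
  + move=> k x _; rewrite normr_ge0/= /v' /= addrAC subrr add0r normrM.
    by rewrite (ger0_norm s0).
  + by move=> k x _; exact: normr_ge0.
- move=> r.
  apply: (@int_pow_cvg0_le _ LT R (leb n) p p1 (E r) s
    (fun k x => enorm (grad (v' k) x - grad phi x)) (fun k x => enorm (grad (v k) x))
    (mE r) _ _ s0 _ _ (dv_cvg r)).
  + move=> k; apply: measurable_enorm => i.
    rewrite (_ : (fun x => _) = (fun x => s * grad (v k) x ord0 i)).
      by apply: measurable_funM; [exact: measurable_cst|exact: mdv].
    by apply/funext => x; have [_ ->] := v'P k; rewrite addrAC subrr add0r mxE.
  + by move=> k; apply: measurable_enorm => i; exact: mdv.
  + move=> k x _; rewrite enorm_ge0/=; have [_ ->] := v'P k.
    by rewrite addrAC subrr add0r enormZ (ger0_norm s0).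
  + by move=> k x _; exact: enorm_ge0.
- apply: (@int_pow_cvg0_le _ ST R (hausdorff n n.-1) p p1 (boundary Omega) s
    (fun k x => `|v' k x - s * g x|) (fun k x => `|v k x - g x|) mB _ _ s0 _ _ vg).
  + move=> k; apply: measurableT_comp; first exact: normr_measurable.
    apply: measurable_funB.
      by apply: continuous_measurable_surface; apply: C1_continuous; have [] := v'P k.
    by apply: measurable_funM; [exact: measurable_cst|exact: mg].
  + move=> k; apply: measurableT_comp; first exact: normr_measurable.
    by apply: measurable_funB; [exact: mvS|exact: mg].
  + move=> k x [clx _]; rewrite normr_ge0/= /v' /= phi0; last by move/KU; exact.
    by rewrite add0r -mulrBr normrM (ger0_norm s0).
  + by move=> k x _; exact: normr_ge0.
Qed.

End compactly_supported.

(** * The equivalence *)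

Lemma trunc_int_pow_cvg d (T : measurableType d) (R : realType)
    (mu : {measure set T -> \bar R}) (p : R) (D : set T) (g : T -> R) :
  1 <= p -> measurable D -> measurable_fun D g ->
  (\int[mu]_(x in D) (`|g x| `^ p)%:E < +oo)%E ->
  (\int[mu]_(x in D) (`|trunc k.+1%:R^-1 (g x)| `^ p)%:E)%E @[k --> \oo] -->
  (\int[mu]_(x in D) (`|g x| `^ p)%:E)%E.
Proof.
move=> p1 mD mg goo; have p0 : 0 < p by exact: lt_le_trans p1.
have k0 (k : nat) : 0 < k.+1%:R^-1 :> R by [].
have mT k : measurable_fun D (fun x => `|trunc k.+1%:R^-1 (g x)|).
  apply: measurableT_comp => //.
  by apply: measurable_continuous_comp => //; exact: trunc_continuous.
have mng : measurable_fun D (fun x => `|g x|) by exact: measurableT_comp.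
have mTp k := measurable_pow p (mT k).
have mgp := measurable_pow p mng.
have tcvg : {ae mu, forall x, D x ->
    (`|trunc k.+1%:R^-1 (g x)| `^ p)%:E @[k --> \oo] --> (`|g x| `^ p)%:E}.
  apply: aeW => x _; apply/fine_cvgP; split; first exact: nearW.
  (* Zeros of g are treated apart, because continuity of the power is drawn from its
     differentiability, which is available at positive arguments. *)
  have [gx0|gx0] := eqVneq (g x) 0.
    apply: cvg_near_cst; apply: nearW => k /=.
    by rewrite gx0 trunc_eq0 ?normr0// ltW.
  have gx : 0 < `|g x| by rewrite normr_gt0.
  have cp : {for `|g x|, continuous (fun y : R => y `^ p)}.
    have [dp _] := is_derive1_powR p gx.
    by apply: differentiable_continuous; exact/derivable1_diffP.
  have /(cvg_comp _ _) := @trunc_cvg R (g x); move=> /(_ _ (fun y : R => y `^ p) _ cp).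
  apply: cvg_trans; apply: near_eq_cvg; apply: nearW => k /=.
  by rewrite ger0_norm// trunc_ge0.
have ig : mu.-integrable D (fun x => (`|g x| `^ p)%:E).
  apply/integrableP; split; first exact: mgp.
  rewrite (eq_integral (fun x => (`|g x| `^ p)%:E))// => x _.
  by rewrite gee0_abs// lee_fin powR_ge0.
have bound : {ae mu, forall x (k : nat), D x ->
    (`|(`|trunc k.+1%:R^-1 (g x)| `^ p)%:E| <= (`|g x| `^ p)%:E)%E}.
  apply: aeW => x k _; rewrite gee0_abs ?lee_fin ?powR_ge0//.
  rewrite ge0_ler_powR ?nnegrE ?(ltW p0)//.
  by rewrite ger0_norm ?trunc_ge0// trunc_le.
by have [] := dominated_convergence mD mTp mgp tcvg ig bound.
Qed.

Lemma scale_cancel (R : realType) (a S e : R) : a < 0 -> 0 < S ->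
  a * (e / (- a * S) * S) = - e.
Proof. by move=> a0 S0; field; rewrite gt_eqF//= lt_eqF. Qed.

Section main_equivalence.
Context {R : realType} {n : nat} (p alpha : R) (p1 : 1 <= p) (Omega : set 'rV[R]_n).
Local Notation LT := (caratheodory_type (@lebesgue_outer R n)).
Local Notation ST := (caratheodory_type (@hausdorff_outer R n n.-1)).
Local Notation U := (exterior Omega).
Local Notation energy G := (\int[leb n]_(x in U) (enorm (G x) `^ p)).
Local Notation surf g := (\int[surface]_(x in boundary Omega) (`|g x| `^ p)).
Local Notation mass u := (\int[leb n]_(x in U) (`|u x| `^ p)).

Lemma Rintegral_pow_ge0 d (T : measurableType d) (mu : {measure set T -> \bar R})
  (D : set T) (f : T -> R) : 0 <= \int[mu]_(x in D) (f x `^ p).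
Proof. by apply: Rintegral_ge0 => x _; exact: powR_ge0. Qed.

(** Translates the nontriviality clauses of the two infima into positivity of the denominators;
    finiteness of the integral makes the real and the extended value agree. *)
Lemma Rintegral_pow_gt0 d (T : measurableType d) (mu : {measure set T -> \bar R})
    (D : set T) (f : T -> R) : measurable D -> in_Lp mu D p f ->
  0 < \int[mu]_(x in D) (`|f x| `^ p) <-> ~ {ae mu, forall x, D x -> f x = 0}.
Proof.
move=> mD [mf foo].
have fin : (\int[mu]_(x in D) (`|f x| `^ p)%:E)%E \is a fin_num.
  rewrite ge0_fin_numE//; apply: integral_ge0 => x _; by rewrite lee_fin powR_ge0.
rewrite lt_neqAle Rintegral_pow_ge0 andbT -(int_pow_eq0 mu p1 mD mf) -(fineK fin).
by split=> [/eqP fp [/esym//]|h]; apply/eqP => fp; apply: h;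
  congr EFin; exact/esym.
Qed.

Lemma sobolev_finite_energy u G : sobolev p U u G -> finite_energy p U u G.
Proof.
move=> [wG [mu_ uoo] GLp]; split => // c c0.
pose A : set 'rV[R]_n := U `&` [set x | c <= `|u x|].
have mU := @measurable_exterior R n Omega.
have mnu : measurable_fun (U : set LT) ((fun x => `|u x|) : LT -> R).
  by apply: measurableT_comp; [exact: normr_measurable|exact: mu_].
have mA : measurable (A : set LT).
  have := mnu mU `[c, +oo[%classic (measurable_itv _).
  rewrite (_ : _ `&` _ = A)//.
  by apply/seteqP; split => x [Ux]; rewrite /= in_itv/= andbT.
have p0 : 0 < p by exact: lt_le_trans p1.
have cp : 0 < c `^ p by rewrite powR_gt0.
have AU : A `<=` U by move=> x [].
have le1 : ((c `^ p)%:E * leb n A <= \int[leb n]_(x in U) (`|u x| `^ p)%:E)%E.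
  rewrite -(integral_cst (leb n) mA); apply: (@le_trans _ _
    (\int[leb n]_(x in A) (`|u x| `^ p)%:E)%E).
    apply: (@le_int_pow _ LT R (leb n) p p1 A (fun=> c) (fun x => `|u x|) mA).
    - exact: measurable_cst.
    - by apply: measurable_funS mnu.
    - by move=> x [_ /= ->]; rewrite ltW.
  apply: (@ge0_subset_integral _ LT R (leb n) A U mA mU (fun x => (`|u x| `^ p)%:E)).
  - by apply: measurable_pow; exact: mnu.
  - by move=> x _; rewrite lee_fin powR_ge0.
  - exact: AU.
suff : leb n A != +oo%E by rewrite -ltey.
apply/eqP => Aoo.
by move: (le_lt_trans le1 uoo); rewrite Aoo mulry gtr0_sg// mul1e ltxx.
Qed.

Lemma energy_fin (G : 'rV[R]_n -> 'rV[R]_n) : in_Lp (leb n) U p (enorm \o G) ->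
  (\int[leb n]_(x in U) (enorm (G x) `^ p)%:E)%E \is a fin_num.
Proof.
move=> [_ Goo]; rewrite ge0_fin_numE; last first.
  by apply: integral_ge0 => x _; rewrite lee_fin powR_ge0.
move: Goo; rewrite (eq_integral (fun x : LT => (enorm (G x) `^ p)%:E))// => x _.
by rewrite /= ger0_norm// enorm_ge0.
Qed.

(** The contrapositive also covers D = 0, where the inverse is 0 by convention. *)
Lemma quotient_lt0 (N D : R) : 0 <= D -> N / D < 0 -> N < 0.
Proof.
move=> D0; apply: contraTT; rewrite -!leNgt => N0.
by rewrite mulr_ge0// invr_ge0.
Qed.

Lemma lambda1_lt0_imp : (lambda1 alpha p Omega < 0)%E ->
  (alpha%:E < alpha_star p Omega)%E.
Proof.
move=> /ereal_inf_lt[_ [u [G [g [sob tr _ ->]]]]]; rewrite lte_fin.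
move=> /(quotient_lt0 (Rintegral_pow_ge0 _ _ _)).
set A := energy G; set S := surf g => AS.
have A0 : 0 <= A by exact: Rintegral_pow_ge0.
have S0 : 0 <= S by exact: Rintegral_pow_ge0.
have Spos : 0 < S.
  by rewrite lt_neqAle S0 andbT; apply/eqP => S0'; move: AS; rewrite -S0' mulr0; lra.
rewrite /alpha_star lteNr; apply: (@le_lt_trans _ _ (A / S)%:E).
  apply: ereal_inf_lbound; exists u, G, g; split => //.
    exact: sobolev_finite_energy.
  have [gLp _] := tr.
  exact/(Rintegral_pow_gt0 (@measurable_boundary R n Omega) gLp).
by rewrite -EFinN lte_fin ltr_pdivrMr//; lra.
Qed.

Lemma lambda1_le u G g : sobolev p U u G -> trace p Omega u G g ->
  ~ {ae leb n, forall x, U x -> u x = 0} -> energy G + alpha * surf g < 0 ->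
  (lambda1 alpha p Omega < 0)%E.
Proof.
move=> sob tr u0 N0.
apply: (@le_lt_trans _ _ ((energy G + alpha * surf g) / mass u)%:E).
  by apply: ereal_inf_lbound; exists u, G, g.
have [_ uLp _] := sob.
have D0 : 0 < mass u by apply/(Rintegral_pow_gt0 (@measurable_exterior R n Omega) uLp).
by rewrite lte_fin ltr_pdivrMr// mul0r.
Qed.

Lemma lt_alpha_star_imp : U !=set0 -> (alpha%:E < alpha_star p Omega)%E ->
  (lambda1 alpha p Omega < 0)%E.
Proof.
move=> U0; rewrite /alpha_star lteNr => /ereal_inf_lt[_ [u [G [g [fe tr g0 ->]]]]].
rewrite -EFinN lte_fin => AS.
have p0 : 0 < p by exact: lt_le_trans p1.
have mB := @measurable_boundary R n Omega.
have [gLp _] := tr.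
have Spos : 0 < surf g by apply/(Rintegral_pow_gt0 mB gLp).
move: AS; rewrite ltr_pdivrMr// => AS.
have A0 : 0 <= energy G by exact: Rintegral_pow_ge0.
have alpha0 : alpha < 0.
  rewrite ltNge; apply/negP => alpha0.
  have : 0 <= alpha * surf g by rewrite mulr_ge0// ltW.
  by move: AS; rewrite mulNr; lra.
have [mg goo] := gLp.
have Sfin : (\int[surface]_(x in boundary Omega) (`|g x| `^ p)%:E)%E \is a fin_num.
  by rewrite ge0_fin_numE//; apply: integral_ge0 => x _; rewrite lee_fin powR_ge0.
have := @trunc_int_pow_cvg _ ST R (hausdorff n n.-1) p (boundary Omega) g p1 mB mg goo.
rewrite -[X in _ --> X](fineK Sfin) => /fine_cvgP[_ Scvg].
(* A strict inequality with a fixed left side: it survives when g is replaced by a truncation T(g)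
   with small d, and the energy does not increase. *)
have cAS : energy G / - alpha < surf g.
  by rewrite ltr_pdivrMr ?oppr_gt0// mulrC.
have [k] : exists k : nat, energy G / - alpha < surf (trunc k.+1%:R^-1 \o g).
  have /cvgr_gt /(_ _ cAS) [N _ HN] := Scvg.
  by exists N; exact: HN (leqnn N).
set d := k.+1%:R^-1 => Sk.
have d0 : 0 < d by rewrite invr_gt0.
have sob := sobolev_trunc p1 d0 fe tr.
have tr' := trace_trunc p1 d0 fe tr.
set G' := (fun x => trunc' d (u x) *: G x) in sob tr'.
have Nneg : energy G' + alpha * surf (trunc d \o g) < 0.
  have AA' : energy G' <= energy G.
    have [_ _ GLp'] := sob; have [_ GLp _] := fe.
    apply: fine_le; [exact: energy_fin GLp'|exact: energy_fin GLp|].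
    exact: (trunc_energy_le p1 d0 fe).
  move: Sk; rewrite ltr_pdivrMr ?oppr_gt0// mulrN => Sk.
  by rewrite -ltrBrDr sub0r mulrC (le_lt_trans AA').
(* A null T(u) is excluded from the Rayleigh quotient; its possibly nonzero trace is then
   transferred to a bump. *)
have [Tu0|] := pselect {ae leb n, forall x, U x -> (trunc d \o u) x = 0}; last first.
  by move=> Tu0; exact: (lambda1_le sob tr').
have G'0 : {ae leb n, forall x, U x -> G' x = 0}.
  apply: (@ae_mono _ LT R (leb n) (fun x => U x -> (trunc d \o u) x = 0) _ _ Tu0).
  by move=> x Tux Ux; rewrite /G' (trunc'_eq0 d0 (Tux Ux)) scale0r.
have [phi [K [Cphi cK KU phi0 phiN0]]] := exists_bump (@open_exterior R n Omega) U0.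
have Tgpos : 0 < surf (trunc d \o g).
  by apply: le_lt_trans Sk; rewrite divr_ge0// oppr_ge0 ltW.
(* Chosen so that the boundary term alpha t [surf (trunc d \o g)] equals minus the energy of phi
   minus 1, which makes the numerator -1. *)
pose t := (energy (grad phi) + 1) / (- alpha * surf (trunc d \o g)).
have E0 : 0 <= energy (grad phi) by exact: Rintegral_pow_ge0.
have aS : 0 < - alpha * surf (trunc d \o g) by rewrite mulr_gt0 ?oppr_gt0.
have t0 : 0 <= t by apply: divr_ge0; [exact: addr_ge0|exact: ltW].
(* The boundary integral is homogeneous of degree p, so scaling the trace by s multiplies it by
   t. *)
pose s := t `^ p^-1.
have s0 : 0 <= s by exact: powR_ge0.
have sp : s `^ p = t by rewrite -powRrM mulVf ?gt_eqF// powRr1.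
have wTu : weak_gradient U (trunc d \o u) G' by case: sob.
have trphi := trace_add_null p1 Cphi KU phi0 s0 wTu Tu0 G'0 tr'.
have sobphi := @sobolev_C1_compact R n p p1 Omega phi K Cphi cK phi0.
apply: (lambda1_le sobphi trphi phiN0).
have [[mTg Tgoo] _] := tr'.
have mTn : measurable_fun (boundary Omega : set ST) ((fun x => `|(trunc d \o g) x|) : ST -> R).
  by apply: measurableT_comp; [exact: normr_measurable|exact: mTg].
have -> : surf (fun x => s * (trunc d \o g) x) = t * surf (trunc d \o g).
  have sg := @int_powZ _ ST R (hausdorff n n.-1) p (boundary Omega) s
    (fun x => `|(trunc d \o g) x|) mB mTn s0 (fun x _ => normr_ge0 _).
  have Tfin : (\int[surface]_(x in boundary Omega)
      (`|(trunc d \o g) x| `^ p)%:E)%E \is a fin_num.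
    rewrite ge0_fin_numE; first exact: Tgoo.
    by apply: integral_ge0 => x _; rewrite lee_fin powR_ge0.
  have sfin : (s `^ p)%:E \is a fin_num by [].
  rewrite -sp; transitivity (fine ((s `^ p)%:E *
      \int[surface]_(x in boundary Omega) (`|(trunc d \o g) x| `^ p)%:E)%E).
    rewrite -sg; congr fine; apply: eq_integral => x _.
    by rewrite normrM (ger0_norm s0).
  exact: fineM.
have -> : alpha * (t * surf (trunc d \o g)) = - (energy (grad phi) + 1).
  exact: scale_cancel.
by rewrite opprD addrA subrr sub0r oppr_lt0.
Qed.

End main_equivalence.

Lemma exterior_bounded_neq0 {R : realType} {n : nat} (Omega : set 'rV[R]_n) :
  (0 < n)%N -> bounded_set Omega -> exterior Omega !=set0.
Proof.
move=> n0 /bounded_set_box[r r0 Or]; exists (const_mx (r + 1)) => clO.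
have : box (const_mx (- r)) (const_mx r) (const_mx (r + 1) : 'rV[R]_n).
  have cB : closed (box (const_mx (- r)) (const_mx r : 'rV[R]_n)).
    by apply: compact_closed; [exact: norm_hausdorff|exact: box_compact].
  rewrite ((closure_id _).1 cB); exact: (closure_subset Or clO).
by move=> /(_ (Ordinal n0)); rewrite !mxE; lra.
Qed.

Theorem lemma3p4 (R : realType) (n : nat) (p alpha : R)
  (Omega : set 'rV[R]_n)
  (n_ge2 : (2 <= n)%N) (p_gt1 : 1 < p) (p_ltn : p < n%:R)
  (Omega_open : open Omega) (Omega_neq0 : Omega !=set0)
  (Omega_bounded : bounded_set Omega)
  (Omega_lipschitz : lipschitz_boundary Omega)
  (Omega_ext_connected : connected (exterior Omega)) :
  (lambda1 alpha p Omega < 0)%E <-> (alpha%:E < alpha_star p Omega)%E.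
Proof.
have p1 := ltW p_gt1; split; first exact: lambda1_lt0_imp.
apply: lt_alpha_star_imp => //; apply: exterior_bounded_neq0 => //.
exact: ltn_trans n_ge2.
Qed.
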